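(* There exist an absolute constant $C>0$ and an adaptive algorithm for the distribution 2-clustering problem in which both cluster distributions are unknown. Given $n,k,\varepsilon$ and $r=\min(|\mathcal I_1|,|\mathcal I_2|)$ (the size of the smaller cluster), it outputs the hidden partition with probability at least $2/3$, using at most $C\big(M\log k+R\big)$ samples, where $M=\max\!\left(\left(\frac{nk}{r\varepsilon^2}\right)^{2/3},\frac{k\sqrt n}{r\varepsilon^2}\right)$ and $$R=\begin{cases}\left(\frac{n^2k\log k}{\varepsilon^4}\right)^{1/3} & \text{if } n\ge\frac{k\log k}{\varepsilon^4},\\[1ex] \frac{\sqrt{nk\log k}}{\varepsilon^2} & \text{if } k\log k\le n\le\frac{k\log k}{\varepsilon^4},\\[1ex] \frac{k\log k}{\varepsilon^2} & \text{if } n\le k\log k.\end{cases}$$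
   Context: Distribution 2-clustering problem: the input is sample access (adaptive, independent samples on request) to $k\ge2$ distributions $D_1,\dots,D_k$ on $[n]$ and a parameter $\varepsilon\in(0,1]$; it is promised that there is a hidden partition $\{\mathcal I_1,\mathcal I_2\}$ of $[k]$ into two nonempty parts such that all $D_a$ with $a$ in the same part are equal, and $\mathrm{d_{TV}}(D_a,D_b)\ge\varepsilon$ whenever $a\in\mathcal I_1$, $b\in\mathcal I_2$. The goal is to output the partition. $\mathrm{d_{TV}}$ is total variation distance; sample complexity is the total number of samples drawn. *)

(* Defs.v *)
From HB Require Import structures.
From mathcomp Require Import all_boot all_order all_algebra.
From mathcomp Require Import all_classical all_reals all_analysis.
Set Implicit Arguments. Unset Strict Implicit. Unset Printing Implicit Defensive.
Import Order.TTheory GRing.Theory Num.Theory.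
Local Open Scope ring_scope.

(* A randomized adaptive sampling algorithm for k distributions on [n] = 'I_n,
   as a finite decision tree:
   - [Out S]     : stop and output the cluster S (the partition {S, ~: S});
   - [Draw a f]  : draw a fresh independent sample x from D_a, continue with f x;
   - [Toss m f]  : internal randomness: pick j uniformly in 'I_(m.+1),
                   continue with f j. *)
Inductive alg (n k : nat) : Type :=
| Out of {set 'I_k}
| Draw of 'I_k & ('I_n -> alg n k)
| Toss (m : nat) of ('I_m.+1 -> alg n k).

Arguments Out {n k}.
Arguments Draw {n k}.
Arguments Toss {n k}.

Inductive uses_at_most (n k : nat) : alg n k -> nat -> Prop :=
| uam_out S B : uses_at_most (Out S) B
| uam_draw a f B : (forall x, uses_at_most (f x) B) -> uses_at_most (Draw a f) B.+1
| uam_toss m f B : (forall j, uses_at_most (f j) B) -> uses_at_most (Toss m f) B.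

(* Probability that t outputs a set satisfying [good], when run on the
   distributions D (D a x = probability of x under D_a).
   (foldr over index_enum is the unlocked form of \sum_i.) *)
Fixpoint prob_output (R : realType) (n k : nat) (D : 'I_k -> 'I_n -> R)
    (good : {set 'I_k} -> bool) (t : alg n k) : R :=
  match t with
  | Out s => if good s then 1 else 0
  | Draw a f =>
      foldr (fun x acc => D a x * prob_output D good (f x) + acc) 0 (index_enum 'I_n)
  | Toss m f =>
      foldr (fun j acc => (m.+1)%:R^-1 * prob_output D good (f j) + acc) 0
            (index_enum 'I_m.+1)
  end.

Definition is_distr (R : realType) (n : nat) (p : 'I_n -> R) : Prop :=
  (forall x, 0 <= p x) /\ \sum_(x < n) p x = 1.

Definition dTV (R : realType) (n : nat) (p q : 'I_n -> R) : R :=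
  2^-1 * \sum_(x < n) `|p x - q x|.

Definition clustering_instance (R : realType) (n k : nat) (eps : R)
    (D : 'I_k -> 'I_n -> R) (I1 : {set 'I_k}) : Prop :=
  [/\ forall a, is_distr (D a),
      I1 != finset.set0, ~: I1 != finset.set0,
      (forall a b, (a \in I1) = (b \in I1) -> D a = D b)
    & (forall a b, a \in I1 -> b \notin I1 -> eps <= dTV (D a) (D b))].

Definition correct_output (k : nat) (I1 : {set 'I_k}) (S : {set 'I_k}) : bool :=
  (S == I1) || (S == ~: I1).

Definition M_term (R : realType) (n k r : nat) (eps : R) : R :=
  Num.max (powR (n%:R * k%:R / (r%:R * eps ^+ 2)) (2 / 3))
          (k%:R * Num.sqrt n%:R / (r%:R * eps ^+ 2)).

Definition R_term (R : realType) (n k : nat) (eps : R) : R :=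
  let L := k%:R * ln k%:R in
  if k%:R * ln k%:R / eps ^+ 4 <= n%:R then
    powR (n%:R ^+ 2 * L / eps ^+ 4) (1 / 3)
  else if L <= n%:R then Num.sqrt (n%:R * L) / eps ^+ 2
  else L / eps ^+ 2.

(* Main.v *)
(** The algorithm first looks for an index [b] in the cluster opposite to index [0],
    and then classifies every index against the pair [0], [b].

    Both stages replace the l1 distance by the weighted l2 distance
    [sum_x w x * (p x - q x) ^ 2], where [w x = 1 / (1 + number of occurrences of x)]
    in a preliminary sample: this is a derandomized form of "flattening" [x] into
    several bins. Cauchy-Schwarz bounds the weighted distance from below by
    [4 eps^2 / sum_x 1 / w x], while the weights cut the variance contributed by heavy
    elements, because the inverse moments of a binomial [Bin(F, p)] are of order
    [1 / (F p)] and [1 / (F p)^2].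

    Search: about [20 k / r] uniformly random candidates are compared with index [0].
    Only index [0] is used for flattening, so that this larger sample is drawn once; each
    comparison uses [m] samples from both distributions and the statistic
    [<A, B>_w], with [A], [B] independent sums of [m] vectors [e_X - e_Y].

    Classification: [N] samples from each of the two reference distributions give a
    linear functional [f = w * A]. With constant probability over the references, [f]
    separates the two clusters relative to its standard deviation, and then the same [f]
    serves all [k] indices: only the short test samples, not the references, are repeated
    [O(log k)] times to bring the error of a majority vote below [1 / k]. *)

Require Import Defs.
From HB Require Import structures.
From mathcomp Require Import all_boot all_order all_algebra.
From mathcomp Require Import all_classical all_reals all_analysis.
From mathcomp Require Import ring lra zify.
Set Implicit Arguments. Unset Strict Implicit. Unset Printing Implicit Defensive.
Import Order.TTheory GRing.Theory Num.Theory.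
Local Open Scope ring_scope.

(** * Sampling programs: sequencing, cost and expectation *)

Section Prog.
Variables (n k : nat).

(** Leaves carry values of any type, so that stages with different results can be chained by [bind];
    [alg] allows only sets at its leaves. *)
Inductive prog (T : Type) : Type :=
| Ret of T
| PDraw of 'I_k & ('I_n -> prog T)
| PToss (m : nat) of ('I_m.+1 -> prog T).

Fixpoint bind (T U : Type) (P : prog T) (f : T -> prog U) : prog U :=
  match P with
  | Ret x => f x
  | PDraw a g => PDraw a (fun x => bind (g x) f)
  | PToss m g => PToss (fun j => bind (g j) f)
  end.

Fixpoint to_alg (P : prog {set 'I_k}) : alg n k :=
  match P with
  | Ret s => Out s
  | PDraw a g => Draw a (fun x => to_alg (g x))
  | PToss m g => Toss m (fun j => to_alg (g j))
  end.

Fixpoint cost_le (T : Type) (P : prog T) (B : nat) : Prop :=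
  match P with
  | Ret _ => True
  | PDraw _ g => if B is B'.+1 then forall x, cost_le (g x) B' else False
  | PToss m g => forall j, cost_le (g j) B
  end.

Lemma cost_leW T (P : prog T) B B' : (B <= B')%N -> cost_le P B -> cost_le P B'.
Proof.
elim: P B B' => [//|a g IH|m g IH] B B' /=; last first.
  by move=> le h j; apply: IH (h j).
by case: B => // B; case: B' => // B' le h x; apply: IH (h x).
Qed.

Lemma cost_bind T U (P : prog T) (f : T -> prog U) B B' :
  cost_le P B -> (forall x, cost_le (f x) B') -> cost_le (bind P f) (B + B').
Proof.
move=> + hf; elim: P B => [x|a g IH|m g IH] B /=.
- by move=> _; apply: cost_leW (hf x); rewrite leq_addl.
- by case: B => // B h x; apply: IH.
- by move=> h j; apply: IH.
Qed.

Lemma to_alg_uses P B : cost_le P B -> uses_at_most (to_alg P) B.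
Proof.
elim: P B => [S|a g IH|m g IH] B /=.
- by move=> _; constructor.
- by case: B => // B h; constructor=> x; apply: IH.
- by move=> h; constructor=> j; apply: IH.
Qed.

Definition pmap (T U : Type) (h : T -> U) (P : prog T) : prog U :=
  bind P (fun x => Ret (h x)).

Lemma cost_pmap T U (h : T -> U) P B : cost_le P B -> cost_le (pmap h P) B.
Proof. by move=> hP; rewrite -[B]addn0; apply: cost_bind. Qed.

(** [Q] runs on fresh samples after [P], so the two summands are independent; likewise [psum m P]
    adds [m] independent runs of [P]. *)
Definition padd (V : nmodType) (P Q : prog V) : prog V :=
  bind P (fun v => pmap (fun u => v + u) Q).

Fixpoint psum (V : nmodType) (m : nat) (P : prog V) : prog V :=
  if m is m'.+1 then padd P (psum m' P) else Ret 0.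

Definition pdraw (V : Type) (a : 'I_k) (g : 'I_n -> V) : prog V :=
  PDraw a (fun x => Ret (g x)).

Lemma cost_padd (V : nmodType) (P Q : prog V) B B' :
  cost_le P B -> cost_le Q B' -> cost_le (padd P Q) (B + B').
Proof. by move=> hP hQ; apply: cost_bind => // x; apply: cost_pmap. Qed.

Lemma cost_psum (V : nmodType) m (P : prog V) B :
  cost_le P B -> cost_le (psum m P) (m * B).
Proof. by move=> hP; elim: m => [|m IH] //=; rewrite mulSn; apply: cost_padd. Qed.

Section Expectation.
Variables (R : realType) (D : 'I_k -> 'I_n -> R).

Fixpoint Ex (T : Type) (P : prog T) (g : T -> R) : R :=
  match P with
  | Ret x => g x
  | PDraw a f => \sum_(x < n) D a x * Ex (f x) g
  | PToss m f => m.+1%:R^-1 * \sum_(j < m.+1) Ex (f j) g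
  end.

Lemma prob_output_to_alg good P :
  prob_output D good (to_alg P) = Ex P (fun S => (good S)%:R).
Proof.
elim: P => [S|a g IH|m g IH] /=.
- by case: (good S).
- by rewrite unlock /=; elim: (index_enum _) => //= x s ->; rewrite IH.
- rewrite mulr_sumr unlock /=.
  by elim: (index_enum _) => //= x s ->; rewrite IH.
Qed.

Lemma Ex_bind T U (P : prog T) (f : T -> prog U) g :
  Ex (bind P f) g = Ex P (fun x => Ex (f x) g).
Proof.
elim: P => [//|a h IH|m h IH] /=.
- by apply: eq_bigr => x _; rewrite IH.
- by congr *%R; apply: eq_bigr => x _; rewrite IH.
Qed.

Lemma Ex_pmap T U (h : T -> U) P g : Ex (pmap h P) g = Ex P (fun x => g (h x)).
Proof. by rewrite Ex_bind. Qed.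

Lemma eq_Ex T (P : prog T) g h : (forall x, g x = h x) -> Ex P g = Ex P h.
Proof. by move=> gh; congr Ex; apply: funext. Qed.

Lemma ExD T (P : prog T) g h :
  Ex P (fun x => g x + h x) = Ex P g + Ex P h.
Proof.
elim: P => [//|a f IH|m f IH] /=.
- by rewrite -big_split; apply: eq_bigr => x _; rewrite IH mulrDr.
- by rewrite -mulrDr -big_split /=; congr *%R; apply: eq_bigr => x _; rewrite IH.
Qed.

Lemma ExZ T (P : prog T) c g : Ex P (fun x => c * g x) = c * Ex P g.
Proof.
elim: P => [//|a f IH|m f IH] /=.
- by rewrite mulr_sumr; apply: eq_bigr => x _; rewrite IH mulrCA.
- by rewrite mulrCA; congr *%R; rewrite mulr_sumr; apply: eq_bigr => x _; rewrite IH.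
Qed.

Lemma ExB T (P : prog T) g h :
  Ex P (fun x => g x - h x) = Ex P g - Ex P h.
Proof.
rewrite -mulN1r -ExZ -ExD; apply: eq_Ex => x; by rewrite mulN1r.
Qed.

Lemma Ex0 T (P : prog T) : Ex P (fun _ => 0) = 0.
Proof. by have := ExZ P 0 (fun _ => 0); rewrite !mul0r. Qed.

Lemma Ex_sum T (P : prog T) (I : Type) (s : seq I) (g : I -> T -> R) :
  Ex P (fun x => \sum_(i <- s) g i x) = \sum_(i <- s) Ex P (g i).
Proof.
elim: s => [|i s IH].
  by rewrite big_nil -[RHS](Ex0 P); apply: eq_Ex => x; rewrite big_nil.
by rewrite big_cons -IH -ExD; apply: eq_Ex => x; rewrite big_cons.
Qed.

Hypothesis hD : forall a, is_distr (D a).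

Lemma D_ge0 a x : 0 <= D a x.
Proof. by case: (hD a). Qed.

Lemma D_sum1 a : \sum_(x < n) D a x = 1.
Proof. by case: (hD a). Qed.

Lemma Ex_cst T (P : prog T) c : Ex P (fun _ => c) = c.
Proof.
elim: P => [//|a f IH|m f IH] /=.
- rewrite (eq_bigr (fun x => D a x * c)); last by move=> x _; rewrite IH.
  by rewrite -mulr_suml D_sum1 mul1r.
- rewrite (eq_bigr (fun x => c)); last by move=> x _; rewrite IH.
  by rewrite sumr_const card_ord -[c *+ _]mulr_natl mulKf // pnatr_eq0.
Qed.

Lemma le_Ex T (P : prog T) g h : (forall x, g x <= h x) -> Ex P g <= Ex P h.
Proof.
move=> gh; elim: P => [//|a f IH|m f IH] /=.
- by apply: ler_sum => x _; rewrite ler_wpM2l // D_ge0.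
- by rewrite ler_wpM2l ?invr_ge0 // ler_sum.
Qed.

Lemma Ex_ge0 T (P : prog T) g : (forall x, 0 <= g x) -> 0 <= Ex P g.
Proof. by move=> g0; rewrite -(Ex0 P); apply: le_Ex. Qed.

Definition Pr T (P : prog T) (A : T -> bool) : R := Ex P (fun x => (A x)%:R).

Lemma Pr_ge0 T (P : prog T) A : 0 <= Pr P A.
Proof. exact: Ex_ge0. Qed.

Lemma Pr_le1 T (P : prog T) A : Pr P A <= 1.
Proof.
by rewrite -[leRHS](Ex_cst P 1); apply: le_Ex => x; case: (A x); rewrite ?lexx ?ler01.
Qed.

Lemma le_Pr T (P : prog T) (A B : T -> bool) :
  (forall x, A x -> B x) -> Pr P A <= Pr P B.
Proof.
move=> AB; apply: le_Ex => x; case: (boolP (A x)) => [/AB ->//|_].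
by rewrite ler0n.
Qed.

Lemma Pr_or T (P : prog T) (A B : T -> bool) :
  Pr P (fun x => A x || B x) <= Pr P A + Pr P B.
Proof.
rewrite -ExD; apply: le_Ex => x.
by case: (A x); case: (B x); rewrite /= ?addr0 ?add0r // lerDl.
Qed.

Lemma PrC T (P : prog T) A : Pr P (fun x => ~~ A x) = 1 - Pr P A.
Proof.
rewrite -[1](Ex_cst P) -ExB; apply: eq_Ex => x.
by case: (A x); rewrite /= ?subr0 ?subrr.
Qed.

Lemma markov_Ex T (P : prog T) g (t c : R) : 0 < t -> (forall x, 0 <= g x) ->
  Ex P g <= c * t -> Pr P (fun x => t < g x) <= c.
Proof.
move=> t0 g0 hg; rewrite -(ler_pM2r t0); apply: le_trans hg.
rewrite mulrC -ExZ; apply: le_Ex => x.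
by case: (ltP t (g x)) => [/ltW|]; rewrite ?mulr1 ?mulr0.
Qed.

Lemma chebyshev_Ex T (P : prog T) g (mu t c : R) : 0 < t ->
  Ex P (fun x => (g x - mu) ^+ 2) <= c * t ^+ 2 ->
  Pr P (fun x => t <= `|g x - mu|) <= c.
Proof.
move=> t0 hg; have t20 : 0 < t ^+ 2 by rewrite exprn_gt0.
rewrite -(ler_pM2r t20); apply: le_trans hg.
rewrite mulrC -ExZ; apply: le_Ex => x.
case: (leP t `|_|) => h; rewrite ?mulr1 ?mulr0 ?sqr_ge0 //.
by rewrite -[leRHS]real_normK ?num_real // lerXn2r ?nnegrE // ltW.
Qed.

(** Union bound over two successive stages. The event [good] belongs to the analysis alone, so it
    may depend on the unknown [D]. *)
Lemma Pr_bind_le T U (P : prog T) (f : T -> prog U) (good : T -> bool) (A : U -> bool)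
    (d c : R) :
  0 <= c -> Pr P (fun x => ~~ good x) <= d -> (forall x, good x -> Pr (f x) A <= c) ->
  Pr (bind P f) A <= d + c.
Proof.
move=> c0 hP hf; rewrite /Pr Ex_bind.
apply: le_trans (_ : Ex P (fun x => (~~ good x)%:R + c) <= _); last first.
  by rewrite ExD Ex_cst lerD2r.
apply: le_Ex => x; case: (boolP (good x)) => [/hf|_].
  by rewrite add0r.
by apply: le_trans (Pr_le1 _ _) _; rewrite lerDl.
Qed.

(** * Mean and variance of additive statistics *)

Section Moments.
Variable (V : nmodType).

(** [phi] is a real observable of the output: the identity for real statistics, [dot f] for random
    vectors. *)
Definition mean (phi : V -> R) (P : prog V) := Ex P phi.
Definition var (phi : V -> R) (P : prog V) := Ex P (fun v => (phi v - mean phi P) ^+ 2).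

(** Bias-variance decomposition: after expanding around the mean, the cross term averages to
    zero. *)
Lemma mse (phi : V -> R) P c :
  Ex P (fun v => (phi v - c) ^+ 2) = var phi P + (mean phi P - c) ^+ 2.
Proof.
pose m := mean phi P.
have -> : Ex P (fun v => (phi v - c) ^+ 2) =
  Ex P (fun v => (phi v - m) ^+ 2 + (2 * (m - c) * (phi v - m) + (m - c) ^+ 2)).
  by apply: eq_Ex => v; ring.
by rewrite ExD ExD Ex_cst ExZ ExB Ex_cst subrr mulr0 add0r.
Qed.

Lemma var_le_sq (phi : V -> R) P : var phi P <= Ex P (fun v => phi v ^+ 2).
Proof.
rewrite [leRHS](_ : _ = Ex P (fun v => (phi v - 0) ^+ 2)).
  by rewrite mse lerDl sqr_ge0.
by apply: eq_Ex => v; rewrite subr0.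
Qed.

Variable phi : V -> R.
Hypothesis phiD : {morph phi : u v / u + v}.
Hypothesis phi0 : phi 0 = 0.

Lemma mean_padd P Q : mean phi (padd P Q) = mean phi P + mean phi Q.
Proof.
rewrite /mean Ex_bind -[X in _ = _ + X](Ex_cst P) -ExD; apply: eq_Ex => v.
by rewrite Ex_pmap -[X in _ = X + _](Ex_cst Q) -ExD; apply: eq_Ex => u.
Qed.

Lemma var_padd P Q : var phi (padd P Q) = var phi P + var phi Q.
Proof.
rewrite {1}/var mean_padd Ex_bind.
transitivity (Ex P (fun v => var phi Q + (phi v - mean phi P) ^+ 2)); last first.
  by rewrite ExD Ex_cst addrC.
apply: eq_Ex => v.
rewrite Ex_pmap.
(* For fixed [v] the square is the deviation of [phi u] from a centre depending only on [v], so
   [mse] applies to [Q] and no covariance has to be computed. *)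
have -> : (phi v - mean phi P) ^+ 2 =
  (mean phi Q - (mean phi P + mean phi Q - phi v)) ^+ 2 by ring.
by rewrite -mse; apply: eq_Ex => u; rewrite phiD; congr (_ ^+ 2); ring.
Qed.

Lemma mean_psum m P : mean phi (psum m P) = m%:R * mean phi P.
Proof.
elim: m => [|m IH] /=; first by rewrite mul0r /mean /= phi0.
by rewrite mean_padd IH -[m.+1]add1n natrD mulrDl mul1r.
Qed.

Lemma var_psum m P : var phi (psum m P) = m%:R * var phi P.
Proof.
elim: m => [|m IH] /=; first by rewrite mul0r /var /mean /= subrr expr0n.
by rewrite var_padd IH -[m.+1]add1n natrD mulrDl mul1r.
Qed.

Lemma mean_pdraw a g : mean phi (pdraw a g) = \sum_(x < n) D a x * phi (g x).
Proof. by []. Qed.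

Lemma var_pdraw_le a g : var phi (pdraw a g) <= \sum_(x < n) D a x * phi (g x) ^+ 2.
Proof. exact: var_le_sq. Qed.

End Moments.

(** Votes for [true] and for [false] are counted in a pair, so that [psum] does the voting. A tie
    yields [false]. *)
Definition majority (L : nat) (P : prog bool) : prog bool :=
  pmap (fun c : nat * nat => (c.2 < c.1)%N)
       (psum L (pmap (fun b : bool => (nat_of_bool b, nat_of_bool (~~ b))) P)).

Lemma cost_majority L P B : cost_le P B -> cost_le (majority L P) (L * B).
Proof. by move=> hP; apply/cost_pmap/cost_psum/cost_pmap. Qed.

(* Markov's inequality for [3 ^ (#wrong - #right)], whose expectation is a power of
   [3 / 10 + (9 / 10) / 3 = 3 / 5]. *)
Lemma Pr_majority L (P : prog bool) (ans : bool) :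
  Pr P (fun b => b != ans) <= 10^-1 ->
  Pr (majority L P) (fun b => b != ans) <= (3 / 5) ^+ L.
Proof.
move=> hP.
pose wr (c : nat * nat) : R := if ans then 3 ^+ c.2 * 3^-1 ^+ c.1
                               else 3 ^+ c.1 * 3^-1 ^+ c.2.
have wrD u v : wr (u + v) = wr u * wr v.
  by rewrite /wr /=; case: (ans); rewrite !exprD; ring.
have wr0 c : 0 <= wr c.
  by rewrite /wr; case: (ans); rewrite mulr_ge0 // exprn_ge0 // invr_ge0.
rewrite /majority /Pr Ex_pmap.
set Q := pmap _ P.
(* A wrong verdict, possibly by a tie, has at least as many wrong votes as right ones, so [wr] is at
   least [1] there. *)
apply: le_trans (_ : Ex (psum L Q) wr <= _).
  apply: le_Ex => -[t f] /=; rewrite /wr /=.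
  have pw i j : (i <= j)%N -> 1 <= (3 : R) ^+ j * 3^-1 ^+ i.
    move=> ij; rewrite -(subnK ij) exprD -mulrA -exprMn divff // expr1n mulr1.
    by rewrite exprn_ege1 // ler1n.
  have := wr0 (t, f); rewrite /wr /=.
  by case: ltnP => h; case: (ans) => /= h0; rewrite ?pw // ltnW.
elim: L => [|L IH] /=; first by rewrite /wr /= !expr0 mulr1; case: (ans).
rewrite Ex_bind exprS (@eq_Ex _ _ _ (fun v => Ex (psum L Q) wr * wr v)); last first.
  by move=> v; rewrite Ex_pmap mulrC -ExZ; apply: eq_Ex => u; rewrite wrD.
rewrite ExZ mulrC; apply: ler_pM => //; try exact: Ex_ge0.
rewrite /Q Ex_pmap (@eq_Ex _ _ _ (fun b => 3^-1 + (3 - 3^-1) * (b != ans)%:R)).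
  by rewrite ExD ExZ Ex_cst; rewrite /Pr in hP; lra.
by move=> b; rewrite /wr; case: (ans); case: b; rewrite /= ?expr0 ?expr1; lra.
Qed.

End Expectation.
End Prog.

(** * Cauchy-Schwarz without square roots *)

Lemma le_double_of_sqr (R : realDomainType) (s x y : R) :
  0 <= x -> 0 <= y -> s ^+ 2 <= x * y -> 2 * s <= x + y.
Proof.
move=> x0 y0 h; rewrite leNgt; apply/negP => hlt.
have : (x + y) ^+ 2 < (2 * s) ^+ 2 by rewrite ltr_pXn2r ?nnegrE ?addr_ge0 //; lra.
by have := sqr_ge0 (x - y); rewrite !expr2 in h *; lra.
Qed.

(** The pointwise bound on [c i ^ 2] replaces the usual choice of [c i] as a root of [a i * b i].
    Induction on the list, with the arithmetic-geometric mean inequality for the cross term. *)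
Lemma cauchy_schwarz_sum (R : realDomainType) (I : Type) (s : seq I) (a b c : I -> R) :
  (forall i, 0 <= a i) -> (forall i, 0 <= b i) ->
  (forall i, c i ^+ 2 <= a i * b i) ->
  (\sum_(i <- s) c i) ^+ 2 <= (\sum_(i <- s) a i) * (\sum_(i <- s) b i).
Proof.
move=> a0 b0 hc; elim: s => [|i s IH]; first by rewrite !big_nil expr0n mulr0.
rewrite !big_cons; set C := \sum_(j <- s) c j in IH *.
set A := \sum_(j <- s) a j in IH *; set B := \sum_(j <- s) b j in IH *.
have A0 : 0 <= A by apply: sumr_ge0.
have B0 : 0 <= B by apply: sumr_ge0.
have : 2 * (c i * C) <= a i * B + A * b i.
  apply: le_double_of_sqr; rewrite ?mulr_ge0 //.
  rewrite exprMn (_ : a i * B * (A * b i) = (a i * b i) * (A * B)); last by ring.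
  by apply: ler_pM; rewrite ?sqr_ge0.
by have := hc i; rewrite !expr2 in IH *; lra.
Qed.

(** * The weighted closeness statistic and its test *)

Section Samples.
Variables (R : realType) (n k : nat) (D : 'I_k -> 'I_n -> R).
Hypothesis hD : forall a, is_distr (D a).
Implicit Types (a b : 'I_k) (f w : 'I_n -> R).

Local Notation Ex := (@Ex n k R D _).
Local Notation Pr := (@Pr n k R D _).
Local Notation D_ge0 := (D_ge0 hD).

Definition unitv (x : 'I_n) : {ffun 'I_n -> R} := [ffun z => (z == x)%:R].

(** Entry [z] is the number of occurrences of [z] in [m] samples from [D a] minus that in [m]
    samples from [D b]. *)
Definition refsum (m : nat) a b : prog n k {ffun 'I_n -> R} :=
  psum m (padd (pdraw a unitv) (pdraw b (fun x => - unitv x))).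

Definition dot f (A : {ffun 'I_n -> R}) : R := \sum_(z < n) f z * A z.

Lemma dotD f : {morph dot f : u v / u + v}.
Proof.
move=> u v; rewrite /dot -big_split; apply: eq_bigr => z _ /=.
by rewrite ffunE mulrDr.
Qed.

Lemma dot0 f : dot f 0 = 0.
Proof. by rewrite /dot big1 // => z _; rewrite ffunE mulr0. Qed.

Lemma dot_unitv f x : dot f (unitv x) = f x.
Proof.
rewrite /dot (bigD1 x) //= ffunE eqxx mulr1 big1 ?addr0 // => z zx.
by rewrite ffunE (negbTE zx) mulr0.
Qed.

Lemma dotN_unitv f x : dot f (- unitv x) = - f x.
Proof.
rewrite -(dot_unitv f x) /dot -sumrN; apply: eq_bigr => z _.
by rewrite ffunE mulrN.
Qed.

Lemma sum_diff a b f :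
  \sum_x D a x * f x + \sum_x D b x * - f x = \sum_x f x * (D a x - D b x).
Proof. by rewrite -big_split; apply: eq_bigr => x _ /=; ring. Qed.

Lemma mean_refsum m a b f :
  mean D (dot f) (refsum m a b) = m%:R * \sum_x f x * (D a x - D b x).
Proof.
rewrite /refsum (mean_psum hD (dotD f) (dot0 f)) (mean_padd hD (dotD f)).
rewrite -sum_diff; congr (_ * (_ + _)); apply: eq_bigr => x _.
  by rewrite dot_unitv.
by rewrite dotN_unitv.
Qed.

Lemma var_refsum m a b f :
  var D (dot f) (refsum m a b) <= m%:R * \sum_x f x ^+ 2 * (D a x + D b x).
Proof.
rewrite /refsum (var_psum hD (dotD f)) (var_padd hD (dotD f)).
rewrite ler_wpM2l //.
apply: le_trans (lerD (var_pdraw_le hD _ _ _) (var_pdraw_le hD _ _ _)) _.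
rewrite -big_split; apply: ler_sum => x _ /=.
by rewrite dot_unitv dotN_unitv sqrrN mulrDr ![_ * f x ^+ 2]mulrC.
Qed.

(** Bias-variance for the coordinate functional at [z]: a variance term plus the squared mean. *)
Lemma refsum_sqr m a b z :
  Ex (refsum m a b) (fun A => A z ^+ 2) <=
    m%:R * (D a z + D b z) + m%:R ^+ 2 * (D a z - D b z) ^+ 2.
Proof.
pose e : 'I_n -> R := fun x => (x == z)%:R.
have eS (g : 'I_n -> R) : \sum_x e x * g x = g z.
  rewrite (bigD1 z) //= /e eqxx mul1r big1 ?addr0 // => x xz.
  by rewrite (negbTE xz) mul0r.
rewrite (@eq_Ex _ _ _ _ _ _ _ (fun A => (dot e A - 0) ^+ 2)); last first.
  by move=> A; rewrite subr0 /dot eS.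
rewrite mse // mean_refsum subr0 eS exprMn lerD2r.
apply: le_trans (var_refsum _ _ _ _) _; rewrite ler_wpM2l //.
rewrite -(eS (fun x => D a x + D b x)); apply: ler_sum => x _.
by rewrite /e; case: eqP; rewrite ?expr1n ?expr0n ?lexx //= !mul0r.
Qed.

(** [sqdist] is the signal of the closeness statistic; [sqmass] and [crossmass] are the coefficients
    of [m ^ 2] and [m ^ 3] in the bound on its variance. *)
Definition sqdist w a b : R := \sum_x w x * (D a x - D b x) ^+ 2.
Definition sqmass w a b : R := \sum_x w x ^+ 2 * (D a x + D b x) ^+ 2.
Definition crossmass w a b : R :=
  \sum_x w x ^+ 2 * (D a x + D b x) * (D a x - D b x) ^+ 2.

(** The averaged sum is the noise, per test sample, of a linear statistic with coefficients
    [w x * A x]; its signal is treated by [refsum_gap] and [refsum_gap_var]. *)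
Lemma refsum_energy m a b w :
  Ex (refsum m a b) (fun A => \sum_x (w x * A x) ^+ 2 * (D a x + D b x)) <=
    m%:R * sqmass w a b + m%:R ^+ 2 * crossmass w a b.
Proof.
rewrite Ex_sum /sqmass /crossmass !mulr_sumr -big_split; apply: ler_sum => x _ /=.
rewrite (@eq_Ex _ _ _ _ _ _ _ (fun A : {ffun _ -> R} => w x ^+ 2 * (D a x + D b x) * A x ^+ 2));
  last by move=> A; ring.
rewrite ExZ.
apply: le_trans (ler_wpM2l _ (refsum_sqr m a b x)) _.
  by rewrite mulr_ge0 ?sqr_ge0 // addr_ge0 // D_ge0.
by rewrite le_eqVlt; apply/orP; left; apply/eqP; ring.
Qed.

Lemma refsum_gap m a b w :
  mean D (dot (fun x => w x * (D a x - D b x))) (refsum m a b) = m%:R * sqdist w a b.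
Proof.
rewrite mean_refsum; congr (_ * _); apply: eq_bigr => x _; ring.
Qed.

Lemma refsum_gap_var m a b w :
  var D (dot (fun x => w x * (D a x - D b x))) (refsum m a b)
    <= m%:R * crossmass w a b.
Proof.
apply: le_trans (var_refsum _ _ _ _) _; rewrite ler_wpM2l //.
by apply: ler_sum => x _; rewrite exprMn mulrAC.
Qed.

Definition linstat (m : nat) a b f : prog n k R :=
  psum m (padd (pdraw a f) (pdraw b (fun x => - f x))).

Lemma mean_linstat m a b f :
  mean D id (linstat m a b f) = m%:R * \sum_x f x * (D a x - D b x).
Proof. by rewrite mean_psum ?mean_padd // -sum_diff. Qed.

Lemma var_linstat m a b f :
  var D id (linstat m a b f) <= m%:R * \sum_x f x ^+ 2 * (D a x + D b x).
Proof.
rewrite /linstat var_psum ?var_padd // ler_wpM2l //.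
apply: le_trans (lerD (var_pdraw_le hD _ _ _) (var_pdraw_le hD _ _ _)) _.
rewrite -big_split; apply: ler_sum => x _ /=.
by rewrite sqrrN mulrDr ![_ * f x ^+ 2]mulrC.
Qed.

(** The two factors of the inner product come from independent samples, so the mean is exactly
    [m ^ 2 * sqdist], with no diagonal correction. *)
Definition closeness_stat w (m : nat) a b : prog n k R :=
  bind (refsum m a b) (fun A => linstat m a b (fun x => w x * A x)).

(** Condition on the first factor [A]: the conditional variance averages to the energy, the
    conditional bias to the variance of the gap, and each contributes one [m ^ 3 * crossmass]. *)
Lemma closeness_stat_mse w m a b :
  Ex (closeness_stat w m a b) (fun T => (T - m%:R ^+ 2 * sqdist w a b) ^+ 2) <=
    m%:R ^+ 2 * sqmass w a b + 2 * m%:R ^+ 3 * crossmass w a b.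
Proof.
rewrite Ex_bind.
pose g : 'I_n -> R := fun x => w x * (D a x - D b x).
apply: le_trans (_ : Ex (refsum m a b) (fun A =>
   m%:R * (\sum_x (w x * A x) ^+ 2 * (D a x + D b x)) +
   m%:R ^+ 2 * (dot g A - m%:R * sqdist w a b) ^+ 2) <= _).
  apply: le_Ex => // A.
  rewrite (mse hD id) lerD // ?var_linstat // mean_linstat.
  rewrite (_ : \sum_x _ = dot g A); last by apply: eq_bigr => x _; rewrite /g; ring.
  by rewrite -exprMn le_eqVlt; apply/orP; left; apply/eqP; ring.
rewrite ExD !ExZ (mse hD (dot g)) refsum_gap subrr expr0n addr0.
have h1 := refsum_energy m a b w.
have h2 := refsum_gap_var m a b w.
have := lerD (ler_wpM2l (ler0n R m) h1) (ler_wpM2l (sqr_ge0 m%:R) h2).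
move/le_trans; apply.
by rewrite le_eqVlt; apply/orP; left; apply/eqP; ring.
Qed.

(** The answer [true] means that the two distributions are judged different. *)
Definition closeness_test w (m : nat) (tau : R) a b : prog n k bool :=
  pmap (fun T : R => tau <= T) (closeness_stat w m a b).

Lemma cost_refsum m a b : cost_le (refsum m a b) (2 * m).
Proof. by rewrite mulnC; apply: cost_psum; exact: (@cost_padd _ _ _ _ _ 1 1). Qed.

Lemma cost_closeness_test w m tau a b : cost_le (closeness_test w m tau a b) (4 * m).
Proof.
rewrite (_ : 4 * m = 2 * m + 2 * m)%N; last lia.
apply: cost_pmap; apply: cost_bind; first exact: cost_refsum.
by move=> A; rewrite mulnC; apply: cost_psum; exact: (@cost_padd _ _ _ _ _ 1 1).
Qed.

(** For equal distributions [sqdist] and [crossmass] vanish. Only the variance [m ^ 2 * sqmass], at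
    most [80 * m ^ 2 / F], has to be compared with the squared threshold. *)
Lemma closeness_test_same w m (F : nat) eps a b : D a = D b -> (0 < n)%N -> (0 < m)%N ->
  0 < eps ->
  \sum_x w x ^+ 2 * D a x ^+ 2 <= 20 / F%:R ->
  (4 * 10 ^+ 8) * n%:R ^+ 2 <= m%:R ^+ 2 * F%:R * eps ^+ 4 ->
  Pr (closeness_test w m (m%:R ^+ 2 * eps ^+ 2 / (20 * n%:R)) a b) id <= 10^-1.
Proof.
move=> ab n0 m0 e0 hb hK.
have nR : 0 < n%:R :> R by rewrite ltr0n.
have mR : 0 < m%:R :> R by rewrite ltr0n.
have F0 : 0 < F%:R :> R.
  rewrite lt0r ler0n andbT; apply/eqP => F0; move: hK.
  by rewrite F0 mulr0 mul0r leNgt mulr_gt0 // exprn_gt0.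
set tau := _ / _.
have tau0 : 0 < tau by rewrite divr_gt0 ?mulr_gt0 // exprn_gt0.
rewrite /closeness_test /Pr Ex_pmap.
have d0 : sqdist w a b = 0.
  by rewrite /sqdist big1 // => x _; rewrite ab subrr expr0n mulr0.
have c0 : crossmass w a b = 0.
  by rewrite /crossmass big1 // => x _; rewrite ab subrr expr0n mulr0.
have b4 : sqmass w a b <= 80 / F%:R.
  rewrite (_ : 80 / F%:R = 4 * (20 / F%:R)); last by field; rewrite gt_eqF.
  apply: le_trans (ler_wpM2l _ hb) => //.
  by rewrite mulr_sumr; apply: ler_sum => x _; rewrite -ab; lra.
apply: le_trans (_ : Pr (closeness_stat w m a b) (fun T => tau <= `|T - 0|) <= _).
  by apply: le_Pr => // T /le_trans; apply; rewrite subr0 ler_norm.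
apply: chebyshev_Ex => //.
have := closeness_stat_mse w m a b; rewrite d0 c0 !mulr0 addr0 => /le_trans; apply.
apply: le_trans (ler_wpM2l _ b4) _; first exact: sqr_ge0.
rewrite mulrA ler_pdivrMr //.
have h : 0 <= m%:R ^+ 2 / n%:R ^+ 2 :> R by rewrite divr_ge0 ?sqr_ge0.
have := ler_wpM2l h hK.
rewrite (_ : _ / _ * (_ * n%:R ^+ 2) = 4 * 10 ^+ 8 * m%:R ^+ 2);
  last by field; rewrite gt_eqF.
rewrite (_ : 10^-1 * _ * _ =
  m%:R ^+ 2 / n%:R ^+ 2 * (m%:R ^+ 2 * F%:R * eps ^+ 4) / (4 * 10 ^+ 3)); last first.
  by rewrite /tau; field; rewrite gt_eqF.
move: (_ / _ * _) => Y hY; rewrite ler_pdivlMr ?mulr_gt0 ?exprn_gt0 //.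
by have := sqr_ge0 (m%:R : R); move: (m%:R ^+ 2) hY => Z; lra.
Qed.

(** One term of [sqmass] already bounds each [w x * (D a x + D b x)] by [B]; taking this factor out
    of [crossmass] leaves [sqdist]. *)
Lemma crossmass_le w a b (B : R) : 0 <= B -> (forall x, 0 <= w x) ->
  sqmass w a b <= B ^+ 2 -> crossmass w a b <= B * sqdist w a b.
Proof.
move=> B0 w0 hB; rewrite /crossmass /sqdist mulr_sumr; apply: ler_sum => x _.
rewrite (_ : _ * _ * _ = (w x * (D a x + D b x)) * (w x * (D a x - D b x) ^+ 2));
  last by ring.
rewrite ler_wpM2r //; first by rewrite mulr_ge0 // sqr_ge0.
have wD0 : 0 <= w x * (D a x + D b x) by rewrite mulr_ge0 ?addr_ge0 ?D_ge0.
suff : (w x * (D a x + D b x)) ^+ 2 <= B ^+ 2 by rewrite ler_pXn2r ?nnegrE.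
apply: le_trans hB; rewrite exprMn /sqmass (bigD1 x) //= lerDl.
by apply: sumr_ge0 => z _; rewrite mulr_ge0 ?sqr_ge0.
Qed.

(** In the search only [D a] is flattened, so [D b] is bounded through [D a] and the difference;
    [w <= 1] turns the difference part into [sqdist]. *)
Lemma sqmass_le w a b : (forall x, 0 <= w x <= 1) ->
  sqmass w a b <= 8 * (\sum_x w x ^+ 2 * D a x ^+ 2) + 2 * sqdist w a b.
Proof.
move=> hw; rewrite /sqmass /sqdist !mulr_sumr -big_split; apply: ler_sum => x _ /=.
have /andP[w0 w1] := hw x.
have h1 : (D a x + D b x) ^+ 2 <= 8 * D a x ^+ 2 + 2 * (D a x - D b x) ^+ 2.
  by have := sqr_ge0 (D a x * 3 - D b x); rewrite !expr2; lra.
apply: le_trans (ler_wpM2l (sqr_ge0 (w x)) h1) _.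
rewrite mulrDr mulrCA lerD2l mulrCA ler_wpM2l // ler_wpM2r ?sqr_ge0 //.
by rewrite expr2 ler_piMl.
Qed.

(** The mean [m ^ 2 * d] is at least twice the threshold, so a miss is a deviation by half the mean.
    Smallness of [sqmass] also controls [crossmass], by [crossmass_le]. *)
Lemma closeness_test_diff w m (F : nat) eps a b : (0 < n)%N -> (0 < m)%N -> (0 < F)%N ->
  0 < eps -> (forall x, 0 <= w x <= 1) ->
  \sum_x w x ^+ 2 * D a x ^+ 2 <= 20 / F%:R ->
  eps ^+ 2 / (10 * n%:R) <= sqdist w a b ->
  (4 * 10 ^+ 8) * n%:R ^+ 2 <= m%:R ^+ 2 * F%:R * eps ^+ 4 ->
  (4 * 10 ^+ 8) * n%:R <= m%:R ^+ 2 * eps ^+ 2 ->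
  Pr (closeness_test w m (m%:R ^+ 2 * eps ^+ 2 / (20 * n%:R)) a b) negb <= 10^-1.
Proof.
move=> n0 m0 F0 e0 hw hb hd hK2 hK3.
have nR : 0 < n%:R :> R by rewrite ltr0n.
have mR : 0 < m%:R :> R by rewrite ltr0n.
have FR : 0 < F%:R :> R by rewrite ltr0n.
have w0 x : 0 <= w x by case/andP: (hw x).
set d := sqdist w a b in hd *.
have d0 : 0 < d by apply: lt_le_trans hd; rewrite divr_gt0 ?exprn_gt0 ?mulr_gt0.
have m2 : 0 < m%:R ^+ 2 :> R by rewrite exprn_gt0.
have e2 : 0 < eps ^+ 2 by rewrite exprn_gt0.
have en : eps ^+ 2 <= 10 * n%:R * d by rewrite -ler_pdivrMl ?mulr_gt0 // mulrC.
(* The size conditions are restated in terms of the actual [d], which may far exceed its lower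
   bound: the noise grows with [d] too. *)
have h3 : 4 * 10 ^+ 7 <= m%:R ^+ 2 * d.
  rewrite -(ler_pM2l nR).
  have := ler_wpM2l (ltW m2) en; rewrite !exprS expr0 in hK3 *; lra.
have h2 : 4 * 10 ^+ 6 <= m%:R ^+ 2 * d ^+ 2 * F%:R.
  have n2 : 0 < n%:R ^+ 2 :> R by rewrite exprn_gt0.
  rewrite -(ler_pM2l n2).
  have e4 : eps ^+ 4 <= 100 * n%:R ^+ 2 * d ^+ 2.
    rewrite (_ : eps ^+ 4 = (eps ^+ 2) ^+ 2); last by ring.
    rewrite (_ : 100 * _ * _ = (10 * n%:R * d) ^+ 2); last by ring.
    by rewrite lerXn2r ?nnegrE ?mulr_ge0 // ltW.
  have := ler_wpM2l (ltW (mulr_gt0 m2 FR)) e4.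
  have -> : m%:R ^+ 2 * F%:R * (100 * n%:R ^+ 2 * d ^+ 2) =
    100 * (n%:R ^+ 2 * (m%:R ^+ 2 * d ^+ 2 * F%:R)) by ring.
  by move: (n%:R ^+ 2 * (m%:R ^+ 2 * d ^+ 2 * F%:R)) => Y; rewrite !exprS expr0 in hK2 *; lra.
have hbm : sqmass w a b <= (m%:R * d / 100) ^+ 2.
  apply: le_trans (sqmass_le _ _ hw) _.
  have : 8 * (\sum_x w x ^+ 2 * D a x ^+ 2) <= (4 * 10 ^+ 5)^-1 * (m%:R ^+ 2 * d ^+ 2) *+ 16.
    apply: le_trans (ler_wpM2l _ hb) _ => //.
    rewrite mulrA ler_pdivrMr // -mulr_natr.
    by rewrite !exprS expr0 in h2 *; lra.
  have : 2 * d <= (10 ^+ 6)^-1 * (m%:R ^+ 2 * d ^+ 2).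
    have := ler_wpM2r (ltW d0) h3.
    by rewrite !exprS expr0; lra.
  rewrite -/d; have : 0 <= m%:R ^+ 2 * d ^+ 2 by rewrite mulr_ge0 ?sqr_ge0.
  rewrite (_ : (m%:R * d / 100) ^+ 2 = (m%:R ^+ 2 * d ^+ 2) / 10000); last by field.
  by move: (m%:R ^+ 2 * d ^+ 2) => Y; rewrite -mulr_natr !exprS expr0; lra.
have hc : crossmass w a b <= m%:R * d / 100 * d.
  by apply: crossmass_le => //; rewrite !mulr_ge0 ?invr_ge0 // ltW.
rewrite /closeness_test /Pr Ex_pmap.
set tau := _ / _.
have tauE : tau <= m%:R ^+ 2 * d / 2.
  rewrite /tau ler_pdivrMr ?mulr_gt0 //.
  by have := ler_wpM2l (ltW m2) en; lra.
apply: le_trans (_ : Pr (closeness_stat w m a b)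
   (fun T => m%:R ^+ 2 * d / 2 <= `|T - m%:R ^+ 2 * d|) <= _).
  apply: le_Pr => // T; rewrite -ltNge => hT.
  by rewrite distrC; apply: le_trans (ler_norm _); lra.
apply: chebyshev_Ex => //; first by rewrite divr_gt0 ?mulr_gt0.
(* In units of [m ^ 4 * d ^ 2] the variance is at most [1 / 10000 + 1 / 50], below the [1 / 40] that
   Chebyshev allows. *)
apply: le_trans (closeness_stat_mse w m a b) _.
have := ler_wpM2l (ltW m2) hbm.
have m3 : 0 <= 2 * m%:R ^+ 3 :> R by rewrite mulr_ge0 // exprn_ge0.
have := ler_wpM2l m3 hc.
have : 0 <= m%:R ^+ 4 * d ^+ 2 :> R by rewrite mulr_ge0 ?exprn_ge0 // ltW.
by rewrite !exprS expr0; lra.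
Qed.

End Samples.

(** * Inverse binomial moments and the flattening weights *)

Section Flattening.
Variables (R : realType) (n k : nat) (D : 'I_k -> 'I_n -> R).
Hypothesis hD : forall a, is_distr (D a).
Implicit Types (a b : 'I_k) (f w : 'I_n -> R).

Local Notation Ex := (@Ex n k R D _).
Local Notation Pr := (@Pr n k R D _).
Local Notation D_ge0 := (D_ge0 hD).
Local Notation D_sum1 := (D_sum1 hD).

Definition counts (F : nat) a : prog n k {ffun 'I_n -> nat} :=
  psum F (pdraw a (fun x => [ffun z => nat_of_bool (z == x)])).

Lemma cost_counts F a : cost_le (counts F a) F.
Proof. by rewrite -[X in cost_le _ X]muln1; apply: cost_psum. Qed.

Lemma counts_rec F a z (g : nat -> R) :
  Ex (counts F.+1 a) (fun A => g (A z)) =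
    D a z * Ex (counts F a) (fun A => g (A z).+1) +
    (1 - D a z) * Ex (counts F a) (fun A => g (A z)).
Proof.
rewrite /counts /= -/(counts F a).
rewrite (bigD1 z) //= Ex_pmap; congr (_ * _ + _).
  by apply: eq_Ex => A; rewrite !ffunE eqxx.
rewrite -(D_sum1 a) [in RHS](bigD1 z) //= addrC addrK mulr_suml.
apply: eq_bigr => x xz; rewrite Ex_pmap; congr (_ * _).
by apply: eq_Ex => A; rewrite !ffunE eq_sym (negbTE xz).
Qed.

(** Size-biasing of the binomial law, proved by conditioning on the first draw. It gives the inverse
    moments below without binomial coefficients. *)
Lemma counts_shift F a z (g : nat -> R) :
  Ex (counts F.+1 a) (fun A => (A z)%:R * g (A z)) =
    F.+1%:R * D a z * Ex (counts F a) (fun A => g (A z).+1).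
Proof.
elim: F g => [|F IH] g; rewrite (counts_rec _ _ _ (fun j => j%:R * g j)).
  by rewrite /= !ffunE /= !mul1r mul0r mulr0 addr0.
rewrite IH.
rewrite (@eq_Ex _ _ _ _ _ _ _
  (fun A : {ffun _ -> nat} => (A z)%:R * g (A z).+1 + g (A z).+1)); last first.
  by move=> A; rewrite -[(A z).+1]addn1 natrD mulrDl mul1r.
rewrite ExD (IH (fun j => g j.+1)) (counts_rec F a z (fun j => g j.+1)).
by rewrite -[F.+2]addn1 natrD; ring.
Qed.

Lemma counts_inv F a z :
  F.+1%:R * D a z * Ex (counts F a) (fun A => (A z).+1%:R^-1) <= 1.
Proof.
rewrite -(counts_shift _ _ _ (fun j => j%:R^-1)) -[leRHS](Ex_cst hD (counts F.+1 a)).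
apply: le_Ex => // A; case: (A z) => [|j]; first by rewrite mul0r ler01.
by rewrite divff // pnatr_eq0.
Qed.

(** [1 / (j + 1) ^ 2] is at most [2 / ((j + 1) * (j + 2))], and two size-biasing steps reduce the
    latter to a probability. *)
Lemma counts_inv_sqr F a z :
  F%:R ^+ 2 * D a z ^+ 2 * Ex (counts F a) (fun A => (A z).+1%:R^-1 ^+ 2) <= 2.
Proof.
have h1 : Ex (counts F a) (fun A => (A z).+1%:R^-1 ^+ 2) <=
    2 * Ex (counts F a) (fun A => ((A z).+1%:R * (A z).+2%:R)^-1).
  rewrite -ExZ; apply: le_Ex => // A.
  rewrite expr2 invfM mulrCA ler_wpM2l ?invr_ge0 //.
  rewrite ler_pdivlMr // mulrC ler_pdivrMr //.
  by rewrite -natrM ler_nat; lia.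
have h2 : F.+1%:R * D a z *
    Ex (counts F a) (fun A => ((A z).+1%:R * (A z).+2%:R)^-1) <=
    Ex (counts F.+1 a) (fun A => (A z).+1%:R^-1).
  rewrite -(counts_shift _ _ _ (fun j => (j%:R * j.+1%:R)^-1)).
  apply: le_Ex => // A; case: (A z) => [|j]; first by rewrite mul0r invr_ge0.
  by rewrite invfM mulVKf // pnatr_eq0.
have h3 := counts_inv F.+1 a z.
have D0 := D_ge0 a z.
set E1 := Ex _ _ in h1 *; set E2 := Ex _ _ in h1 h2; set E3 := Ex _ _ in h2 h3.
have E20 : 0 <= E2 by apply: Ex_ge0 => // A; rewrite invr_ge0 mulr_ge0.
have p0 : 0 <= F.+2%:R * D a z by rewrite mulr_ge0.
have h4 := le_trans (ler_wpM2l p0 h2) h3.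
apply: le_trans (_ : F%:R ^+ 2 * D a z ^+ 2 * (2 * E2) <= _).
  by rewrite ler_wpM2l // mulr_ge0 // sqr_ge0.
apply: le_trans (_ : 2 * (F.+2%:R * D a z * (F.+1%:R * D a z * E2)) <= _); last by lra.
rewrite (_ : _ * _ * (2 * E2) = 2 * (F%:R * D a z * (F%:R * D a z * E2))); last by ring.
rewrite ler_wpM2l //; apply: ler_pM; rewrite ?mulr_ge0 //.
  by rewrite ler_wpM2r // ler_nat; lia.
by rewrite ler_wpM2r // ler_wpM2r // ler_nat.
Qed.

Lemma counts_mean F a z : Ex (counts F a) (fun A => (A z)%:R) = F%:R * D a z.
Proof.
case: F => [|F]; first by rewrite mul0r /= ffunE.
rewrite (@eq_Ex _ _ _ _ _ _ _ (fun A : {ffun _ -> nat} => (A z)%:R * 1)).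
  by rewrite (counts_shift _ _ _ (fun _ => 1)) Ex_cst // mulr1.
by move=> A; rewrite mulr1.
Qed.

Lemma inv_natS_itv (j : nat) : 0 <= (j.+1%:R : R)^-1 <= 1.
Proof. by rewrite invr_ge0 ler0n /= invf_le1 // ler1n. Qed.

Definition flatten1 (A : {ffun 'I_n -> nat}) (x : 'I_n) : R := (A x).+1%:R^-1.

(** The first condition bounds the share of [D a] in [sqmass]; the second bounds the sum of the
    inverse weights needed for Cauchy-Schwarz. *)
Definition flat1_good (F : nat) a (A : {ffun 'I_n -> nat}) : bool :=
  (\sum_x flatten1 A x ^+ 2 * D a x ^+ 2 <= 20 / F%:R) &&
  (\sum_(x < n) (A x).+1%:R <= 40 * n%:R :> R).

(** Markov twice, at [1 / 20] each. Since the weights are at most [1], [counts_inv] bounds the mean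
    of the first sum by [1 / F]; the second has mean [F + n], at most [2 * n]. *)
Lemma Pr_flat1_good F a : (0 < n)%N -> (0 < F <= n)%N ->
  Pr (counts F a) (fun A => ~~ flat1_good F a A) <= 10^-1.
Proof.
move=> n0 /andP[F0 Fn].
have FR : 0 < F%:R :> R by rewrite ltr0n.
apply: le_trans (_ : Pr (counts F a) (fun A =>
    (20 / F%:R < \sum_x flatten1 A x ^+ 2 * D a x ^+ 2) ||
    (40 * n%:R < \sum_(x < n) (A x).+1%:R :> R)) <= _).
  by apply: le_Pr => // A; rewrite /flat1_good negb_and -!ltNge.
apply: le_trans (Pr_or hD _ _ _) _.
rewrite (_ : 10^-1 = 20^-1 + 20^-1); last by lra.
apply: lerD.
  apply: markov_Ex => //.
  - by rewrite divr_gt0.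
  - by move=> A; apply: sumr_ge0 => x _; rewrite mulr_ge0 ?sqr_ge0.
  rewrite Ex_sum (_ : _ * _ = \sum_x D a x / F%:R); last first.
    by rewrite -mulr_suml D_sum1; field; rewrite gt_eqF.
  apply: ler_sum => x _; rewrite ler_pdivlMr //.
  rewrite (@eq_Ex _ _ _ _ _ _ _
     (fun A => D a x ^+ 2 * flatten1 A x ^+ 2)); last by move=> A; rewrite mulrC.
  rewrite ExZ.
  have h : Ex (counts F a) (fun A => flatten1 A x ^+ 2) <=
           Ex (counts F a) (fun A => (A x).+1%:R^-1).
    apply: le_Ex => // A; have /andP[h0 h1] := inv_natS_itv (A x).
    by rewrite /flatten1 expr2 ler_piMl.
  have h2 := counts_inv F a x.
  have D0 := D_ge0 a x.
  set E := Ex _ _ in h2 h.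
  have E0 : 0 <= E by apply: Ex_ge0 => // A; rewrite invr_ge0.
  have h3 : F%:R * D a x * E <= 1.
    by apply: le_trans h2; rewrite ler_wpM2r // ler_wpM2r // ler_nat.
  have h4 := ler_wpM2l (sqr_ge0 (D a x)) h.
  apply: le_trans (_ : D a x ^+ 2 * E * F%:R <= _); first by rewrite ler_wpM2r // ltW.
  by have := ler_wpM2l D0 h3; rewrite expr2; lra.
apply: markov_Ex => //.
- by rewrite mulr_gt0 // ltr0n.
- by move=> A; apply: sumr_ge0.
rewrite Ex_sum (eq_bigr (fun x => F%:R * D a x + 1)); last first.
  move=> x _; rewrite -counts_mean -[X in _ + X](Ex_cst hD (counts F a)) -ExD.
  by apply: eq_Ex => A; rewrite -natr1.
rewrite big_split /= -mulr_sumr D_sum1 sumr_const card_ord mulr1.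
have : F%:R <= n%:R :> R by rewrite ler_nat.
by lra.
Qed.

(** Cauchy-Schwarz for the l1 distance split by the weights [w] and [1 / w]; the [4] arises because
    this distance is twice [dTV]. *)
Lemma sqdist_ge w a b eps S : 0 <= eps -> (forall x, 0 < w x) ->
  \sum_x (w x)^-1 <= S -> eps <= dTV (D a) (D b) -> 4 * eps ^+ 2 <= sqdist D w a b * S.
Proof.
move=> e0 w0 hS; rewrite /dTV => hd.
have d0 : 0 <= sqdist D w a b.
  by apply: sumr_ge0 => x _; rewrite mulr_ge0 ?sqr_ge0 // ltW.
apply: le_trans (ler_wpM2l d0 hS).
apply: le_trans (_ : (\sum_x `|D a x - D b x|) ^+ 2 <= _); last first.
  apply: cauchy_schwarz_sum => x; first by rewrite mulr_ge0 ?sqr_ge0 // ltW.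
    by rewrite invr_ge0 ltW.
  by rewrite real_normK ?num_real // mulrAC divff ?mul1r // gt_eqF.
rewrite (_ : 4 * eps ^+ 2 = (2 * eps) ^+ 2); last by ring.
rewrite lerXn2r ?nnegrE ?mulr_ge0 ?sumr_ge0 //.
by move: hd; move: (\sum_x _) => X; lra.
Qed.

Definition flatten2 (A B : {ffun 'I_n -> nat}) (x : 'I_n) : R := (A x + B x).+1%:R^-1.

Definition counts2 (F : nat) a b : prog n k ({ffun 'I_n -> nat} * {ffun 'I_n -> nat}) :=
  bind (counts F a) (fun A => pmap (fun B => (A, B)) (counts F b)).

Lemma cost_counts2 F a b : cost_le (counts2 F a b) (F + F).
Proof. by apply: cost_bind => [|A]; [|apply: cost_pmap]; apply: cost_counts. Qed.

Lemma Ex_counts2_fst F a b g :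
  Ex (counts2 F a b) (fun AB => g AB.1) = Ex (counts F a) g.
Proof.
rewrite Ex_bind; apply: eq_Ex => A; rewrite Ex_pmap.
exact: (Ex_cst hD (counts F b) (g A)).
Qed.

Lemma Ex_counts2_snd F a b g :
  Ex (counts2 F a b) (fun AB => g AB.2) = Ex (counts F b) g.
Proof.
rewrite Ex_bind -[RHS](Ex_cst hD (counts F a)).
by apply: eq_Ex => A; rewrite Ex_pmap.
Qed.

Lemma flatten2_le A B x :
  flatten2 A B x <= flatten1 A x /\ flatten2 A B x <= flatten1 B x.
Proof. by rewrite /flatten2 /flatten1; split; rewrite lef_pV2 ?posrE ?ltr0n // ler_nat; lia. Qed.

Lemma flatten2_itv A B x : 0 < flatten2 A B x <= 1.
Proof. by rewrite invr_gt0 ltr0n /=; case/andP: (inv_natS_itv (A x + B x)). Qed.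

Local Notation sig a b x := (D a x + D b x).
Local Notation Ex2 F a b g := (Ex (counts2 F a b) (fun AB => g (flatten2 AB.1 AB.2))).

(** Adding the other sample's counts only lowers the weight, so each of the two masses is handled by
    the inverse moment of its own sample. *)
Lemma Ex_flatten2 F a b x :
  F%:R * sig a b x * Ex2 F a b (fun w => w x) <= 2.
Proof.
have -> : F%:R * sig a b x * Ex2 F a b (fun w => w x) =
   F%:R * D a x * Ex2 F a b (fun w => w x) + F%:R * D b x * Ex2 F a b (fun w => w x).
  by ring.
have aux c (E : R) (E' : R) : E <= E' -> 0 <= E' -> F.+1%:R * D c x * E' <= 1 ->
    F%:R * D c x * E <= 1.
  move=> h E0 h1; apply: le_trans h1.
  apply: le_trans (ler_wpM2l _ h) _; first by rewrite mulr_ge0 ?D_ge0.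
  by rewrite ler_wpM2r // ler_wpM2r ?D_ge0 // ler_nat.
rewrite [2](_ : _ = 1 + 1) // lerD //.
  apply: aux (counts_inv F a x); last by apply: Ex_ge0 => // A; rewrite invr_ge0.
  rewrite -(Ex_counts2_fst F a b (fun A => (A x).+1%:R^-1)); apply: le_Ex => // -[A B].
  by case: (flatten2_le A B x).
apply: aux (counts_inv F b x); last by apply: Ex_ge0 => // A; rewrite invr_ge0.
rewrite -(Ex_counts2_snd F a b (fun A => (A x).+1%:R^-1)); apply: le_Ex => // -[A B].
by case: (flatten2_le A B x).
Qed.

Lemma Ex_flatten2_sqr F a b x :
  F%:R ^+ 2 * sig a b x ^+ 2 * Ex2 F a b (fun w => w x ^+ 2) <= 8.
Proof.
have D0 := D_ge0 a x; have D1 := D_ge0 b x.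
set E := Ex _ _.
have E0 : 0 <= E by apply: Ex_ge0 => // A; rewrite sqr_ge0.
have ha : F%:R ^+ 2 * D a x ^+ 2 * E <= 2.
  apply: le_trans (counts_inv_sqr F a x); rewrite ler_wpM2l //.
    by rewrite mulr_ge0 // sqr_ge0.
  rewrite -(Ex_counts2_fst F a b (fun A => (A x).+1%:R^-1 ^+ 2)); apply: le_Ex => // -[A B].
  case: (flatten2_le A B x) => h _; case/andP: (flatten2_itv A B x) => h0 _.
  by rewrite lerXn2r // nnegrE ?invr_ge0 // ltW.
have hb : F%:R ^+ 2 * D b x ^+ 2 * E <= 2.
  apply: le_trans (counts_inv_sqr F b x); rewrite ler_wpM2l //.
    by rewrite mulr_ge0 // sqr_ge0.
  rewrite -(Ex_counts2_snd F a b (fun A => (A x).+1%:R^-1 ^+ 2)); apply: le_Ex => // -[A B].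
  case: (flatten2_le A B x) => _ h; case/andP: (flatten2_itv A B x) => h0 _.
  by rewrite lerXn2r // nnegrE ?invr_ge0 // ltW.
have : 0 <= F%:R ^+ 2 * E by rewrite mulr_ge0 // sqr_ge0.
move: (F%:R ^+ 2) ha hb => f2 ha hb f20.
(* [(p + q) ^ 2 <= 2 * p ^ 2 + 2 * q ^ 2], whence [8 = 2 * (2 + 2)]. *)
have := mulr_ge0 f20 (sqr_ge0 (D a x - D b x)).
by rewrite !expr2 in ha hb *; lra.
Qed.

(** The inverse of the mean of [1 / w] for [w] the random weight [flatten2]: a deterministic proxy,
    available before the sample is drawn. *)
Definition ideal (F : nat) a b (x : 'I_n) : R := (1 + F%:R * sig a b x)^-1.

Lemma ideal_gt0 F a b x : 0 < ideal F a b x.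
Proof. by rewrite invr_gt0 ltr_pwDl // mulr_ge0 // addr_ge0 // D_ge0. Qed.

Lemma sqdist_ideal F a b eps : (0 < n)%N -> (F <= n)%N -> 0 <= eps ->
  eps <= dTV (D a) (D b) -> 4 * eps ^+ 2 <= 3 * n%:R * sqdist D (ideal F a b) a b.
Proof.
move=> n0 Fn e0 hd; rewrite [leRHS]mulrC.
apply: sqdist_ge => // [x|]; first exact: ideal_gt0.
under eq_bigr do rewrite invrK.
rewrite big_split /= -mulr_sumr big_split /= !D_sum1 sumr_const card_ord.
have : F%:R <= n%:R :> R by rewrite ler_nat.
by lra.
Qed.

Definition flat2_good (F : nat) a b (AB : {ffun 'I_n -> nat} * {ffun 'I_n -> nat}) : bool :=
  let w := flatten2 AB.1 AB.2 in let v := sqdist D (ideal F a b) a b in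
  [&& v <= 40 * sqdist D w a b,
      crossmass D w a b <= 500 * v / F%:R & sqmass D w a b <= 160 / F%:R].

(** Three Markov bounds at [1 / 40] each. Markov gives no lower bound on the weighted distance
    directly, hence the detour through the upper bound on [u]. *)
Lemma Pr_flat2_good F a b : (0 < F)%N -> 0 < sqdist D (ideal F a b) a b ->
  Pr (counts2 F a b) (fun AB => ~~ flat2_good F a b AB) <= 3 / 40.
Proof.
move=> F0 v0; set v := sqdist D _ a b in v0.
have FR : 0 < F%:R :> R by rewrite ltr0n.
have K500 : 0 < 500 :> R by rewrite ltr0n.
have K160 : 0 < 160 :> R by rewrite ltr0n.
have del0 x : 0 <= (D a x - D b x) ^+ 2 by exact: sqr_ge0.
have sig0 x : 0 <= sig a b x by rewrite addr_ge0 ?D_ge0.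
pose w (AB : {ffun 'I_n -> nat} * {ffun 'I_n -> nat}) := flatten2 AB.1 AB.2.
have w0 AB x : 0 < w AB x by case/andP: (flatten2_itv AB.1 AB.2 x).
have w1 AB x : w AB x <= 1 by case/andP: (flatten2_itv AB.1 AB.2 x).
pose u AB := \sum_x ideal F a b x ^+ 2 * (D a x - D b x) ^+ 2 * (w AB x)^-1.
apply: le_trans (_ : Pr (counts2 F a b) (fun AB => (40 * v < u AB) ||
   ((500 * v / F%:R < crossmass D (w AB) a b) || (160 / F%:R < sqmass D (w AB) a b))) <= _).
  apply: le_Pr => // AB; rewrite /flat2_good !negb_and -!ltNge -/v -/(w AB).
  case/or3P => [h|->|->]; rewrite ?orbT //.
  (* Cauchy-Schwarz turns the bound on [u], whose expectation is [v], into a lower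
     bound on the weighted distance. *)
  rewrite ltNge; apply/orP; left; apply/negP => hu.
  have CS : v ^+ 2 <= sqdist D (w AB) a b * u AB.
    apply: cauchy_schwarz_sum => x.
    - by rewrite mulr_ge0 // ltW.
    - by rewrite mulr_ge0 ?invr_ge0 ?(ltW (w0 _ _)) // mulr_ge0 // sqr_ge0.
    - rewrite le_eqVlt; apply/orP; left; apply/eqP; field.
      by rewrite gt_eqF.
  have d0 : 0 <= sqdist D (w AB) a b by apply: sumr_ge0 => x _; rewrite mulr_ge0 // ltW.
  have := le_trans CS (ler_wpM2l d0 hu).
  rewrite expr2 mulrA ler_pM2r // mulrC => h'.
  by move: h; rewrite ltNge h'.
apply: le_trans (Pr_or hD _ _ _) _.
rewrite (_ : 3 / 40 = 40^-1 + (40^-1 + 40^-1)); last by lra.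
apply: lerD; last (apply: le_trans (Pr_or hD _ _ _) _; apply: lerD).
- apply: markov_Ex => //; first by rewrite mulr_gt0.
    move=> AB; apply: sumr_ge0 => x _.
    by rewrite mulr_ge0 ?invr_ge0 ?(ltW (w0 _ _)) // mulr_ge0 // sqr_ge0.
  rewrite mulKf // /u Ex_sum; apply: ler_sum => x _; rewrite ExZ.
  (* The mean of [1 / w] cancels one of the two factors [ideal] in [u]. *)
  have -> : Ex (counts2 F a b) (fun AB => (w AB x)^-1) = (ideal F a b x)^-1.
    rewrite (@eq_Ex _ _ _ _ _ _ _ (fun AB : {ffun 'I_n -> nat} * {ffun 'I_n -> nat} =>
      1 + (AB.1 x)%:R + (AB.2 x)%:R)); last first.
      by move=> AB; rewrite /w invrK -natr1 natrD; ring.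
    rewrite ExD ExD Ex_cst // (Ex_counts2_fst F a b (fun A : {ffun 'I_n -> nat} => (A x)%:R)).
    rewrite (Ex_counts2_snd F a b (fun A : {ffun 'I_n -> nat} => (A x)%:R)).
    by rewrite !counts_mean invrK; ring.
  rewrite le_eqVlt; apply/orP; left; apply/eqP; field.
  by rewrite gt_eqF // ideal_gt0.
- apply: (markov_Ex hD); first exact: divr_gt0 (mulr_gt0 K500 v0) FR.
    by move=> AB; apply: sumr_ge0 => x _; rewrite mulr_ge0 // mulr_ge0 // sqr_ge0.
  rewrite (_ : _ * _ = 25 / 2 * v / F%:R); last by field; rewrite gt_eqF.
  rewrite /v /sqdist mulr_sumr mulr_suml Ex_sum; apply: ler_sum => x _.
  rewrite (@eq_Ex _ _ _ _ _ _ _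
    (fun AB => (sig a b x * (D a x - D b x) ^+ 2) * w AB x ^+ 2)); last first.
    by move=> AB; rewrite /w; ring.
  rewrite ExZ ler_pdivlMr //.
  have h := Ex_flatten2_sqr F a b x; set E := Ex _ _ in h *.
  have E0 : 0 <= E by apply: Ex_ge0 => // AB; rewrite sqr_ge0.
  have E1 : E <= 1.
    rewrite -[leRHS](Ex_cst hD (counts2 F a b)); apply: le_Ex => // AB.
    by apply: exprn_ile1; [apply: ltW (w0 AB x) | apply: w1].
  rewrite [leLHS](_ : _ = F%:R * sig a b x * E * (D a x - D b x) ^+ 2); last by ring.
  rewrite [leRHS]mulrA ler_wpM2r //.
  set y := F%:R * sig a b x; have y0 : 0 <= y by rewrite mulr_ge0.
  have y1 : 0 < 1 + y by lra.
  rewrite /ideal -/y ler_pdivlMr //.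
  (* [2 * y * E <= y ^ 2 * E + E <= 9], so [y * (1 + y) * E <= 9 / 2 + 8 = 25 / 2], and [500] is
     [40] times this. *)
  have : y ^+ 2 * E <= 8 by rewrite exprMn.
  by have := mulr_ge0 E0 (sqr_ge0 (y - 1)); rewrite !expr2; lra.
- apply: (markov_Ex hD); first exact: divr_gt0 K160 FR.
    by move=> AB; apply: sumr_ge0 => x _; rewrite mulr_ge0 // sqr_ge0.
  rewrite (_ : _ * _ = \sum_x 2 / F%:R * sig a b x); last first.
    by rewrite -mulr_sumr big_split /= !D_sum1; field; rewrite gt_eqF.
  rewrite Ex_sum; apply: ler_sum => x _.
  rewrite mulrAC ler_pdivlMr //.
  apply: le_trans (_ : Ex (counts2 F a b) (fun AB => sig a b x ^+ 2 * w AB x) * F%:R <= _).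
    apply: ler_wpM2r; first exact: ltW.
    apply: le_Ex => // AB.
    by rewrite mulrC ler_wpM2l ?sqr_ge0 // expr2 ler_piMl // ltW.
  rewrite ExZ; have := Ex_flatten2 F a b x.
  by move/(ler_wpM2l (sig0 x)); rewrite expr2 /w; lra.
Qed.

End Flattening.

(** * A reference functional and the classification of every index *)

Section Classification.
Variables (R : realType) (n k : nat) (D : 'I_k -> 'I_n -> R).
Hypothesis hD : forall a, is_distr (D a).
Implicit Types (a b z : 'I_k) (f w : 'I_n -> R).

Local Notation Ex := (@Ex n k R D _).
Local Notation Pr := (@Pr n k R D _).
Local Notation D_ge0 := (D_ge0 hD).

(** With [H] the gap and [G] the noise sum, the classification statistic has mean [m * H] up to sign
    and variance at most [5 * m * G]; [50 * G <= m * H ^ 2] makes the Chebyshev error [1 / 10]. *)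
Definition classifier_good (m : nat) a b f : bool :=
  (0 < \sum_x f x * (D a x - D b x)) &&
  (50 * (\sum_x f x ^+ 2 * (D a x + D b x)) <=
     m%:R * (\sum_x f x * (D a x - D b x)) ^+ 2).

Definition reference (F N : nat) a b : prog n k ('I_n -> R) :=
  bind (counts2 n F a b) (fun AB =>
    pmap (fun V : {ffun 'I_n -> R} => fun x => flatten2 R AB.1 AB.2 x * V x)
         (refsum R n N a b)).

Lemma cost_reference F N a b : cost_le (reference F N a b) (2 * F + 2 * N).
Proof.
apply: cost_bind => [|AB]; last by apply: cost_pmap; apply: cost_refsum.
by rewrite mul2n -addnn; apply: cost_counts2.
Qed.

(** Chebyshev keeps the signal [dot g V] above half its mean [N * d], and Markov bounds the noise
    [G V]; each fails with probability at most [1 / 40]. *)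
Lemma Pr_refsum_classifier_good w (N m : nat) (F v : R) a b :
  (0 < N)%N -> (0 < m)%N -> 0 < F -> 0 < v ->
  v <= 40 * sqdist D w a b ->
  crossmass D w a b <= 500 * v / F -> sqmass D w a b <= 160 / F ->
  2 * 10 ^+ 8 <= N%:R * F * v -> 10 ^+ 10 <= m%:R * N%:R * F * v ^+ 2 ->
  10 ^+ 11 <= m%:R * F * v ->
  Pr (refsum R n N a b) (fun V => ~~ classifier_good m a b (fun x => w x * V x)) <= 2 / 40.
Proof.
move=> N0 m0 F0 v0 hv hc hb k1 k2 k3.
have NR : 0 < N%:R :> R by rewrite ltr0n.
have mR : 0 < m%:R :> R by rewrite ltr0n.
set d := sqdist D w a b in hv.
set c := crossmass D w a b in hc.
set bb := sqmass D w a b in hb.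
have d0 : 0 < d by lra.
have c0 : 0 <= c.
  apply: sumr_ge0 => x _; rewrite mulr_ge0 ?sqr_ge0 // mulr_ge0 ?sqr_ge0 //.
  by rewrite addr_ge0 ?D_ge0.
have b0 : 0 <= bb by apply: sumr_ge0 => x _; rewrite mulr_ge0 ?sqr_ge0.
have d2 : v ^+ 2 <= 16 * 10 ^+ 2 * d ^+ 2.
  rewrite (_ : _ * d ^+ 2 = (40 * d) ^+ 2); last by ring.
  by rewrite lerXn2r ?nnegrE ?(ltW v0) // mulr_ge0 // ltW.
have hcF : c * F <= 5 * 10 ^+ 2 * v.
  by move: hc; rewrite ler_pdivlMr // !exprS expr0; lra.
have hbF : bb * F <= 160 by move: hb; rewrite ler_pdivlMr.
pose g : 'I_n -> R := fun x => w x * (D a x - D b x).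
have dotg (V : {ffun 'I_n -> R}) : \sum_x w x * V x * (D a x - D b x) = dot g V.
  by apply: eq_bigr => x _; rewrite /g; ring.
pose e1 (V : {ffun 'I_n -> R}) := N%:R * d / 2 <= `|dot g V - N%:R * d|.
pose G (V : {ffun 'I_n -> R}) := \sum_x (w x * V x) ^+ 2 * (D a x + D b x).
(* The last summand makes [t] visibly positive, as Markov requires, and is negligible against the
   squared signal. *)
pose t := 40 * (N%:R * bb + N%:R ^+ 2 * c) + m%:R * (N%:R * d) ^+ 2 / (10 ^+ 4).
have G0 V : 0 <= G V.
  by apply: sumr_ge0 => x _; rewrite mulr_ge0 ?sqr_ge0 // addr_ge0 ?D_ge0.
have Nd0 : 0 < N%:R * d by rewrite mulr_gt0.
have q0 : 0 < m%:R * (N%:R * d) ^+ 2 by rewrite mulr_gt0 // exprn_gt0.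
(* [k2] pays for the [sqmass] term and [k3] for the [crossmass] term; [k1] is kept for the
   signal. *)
have kb : 40 * (N%:R * bb + N%:R ^+ 2 * c) <= m%:R * (N%:R * d) ^+ 2 / (4 * 10 ^+ 2).
  rewrite -(ler_pM2r F0).
  have p1 := ler_wpM2l (sqr_ge0 (N%:R : R)) hcF.
  have p2 := ler_wpM2l (mulr_ge0 (sqr_ge0 (N%:R : R)) (ltW v0)) k3.
  have p3 := ler_wpM2l (mulr_ge0 (mulr_ge0 (ltW mR) (sqr_ge0 N%:R)) (ltW F0)) d2.
  have p4 := ler_wpM2l (ltW NR) hbF.
  have p5 := ler_wpM2l (ltW NR) k2.
  by rewrite !exprS !expr0 in p1 p2 p3 p4 p5 *; lra.
have t0 : 0 < t.
  by rewrite /t ltr_wpDl ?divr_gt0 ?exprn_gt0 // mulr_ge0 // addr_ge0 // mulr_ge0 ?sqr_ge0.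
apply: le_trans (_ : Pr (refsum R n N a b) (fun V => e1 V || (t < G V)) <= _).
  apply: le_Pr => // V; apply: contraR; rewrite negb_or -ltNge -leNgt.
  case/andP=> h1 h2; rewrite /classifier_good dotg -/(G V).
  have h3 : N%:R * d / 2 <= dot g V.
    by have := ler_norm (N%:R * d - dot g V); rewrite distrC; lra.
  apply/andP; split; first by apply: lt_le_trans h3; rewrite divr_gt0.
  apply: le_trans (_ : m%:R * (N%:R * d / 2) ^+ 2 <= _); last first.
    by rewrite ler_wpM2l // lerXn2r ?nnegrE //; lra.
  by move: h2 kb q0; rewrite /t !exprS expr0; lra.
apply: le_trans (Pr_or hD _ _ _) _.
rewrite (_ : 2 / 40 = 40^-1 + 40^-1); last by lra.
apply: lerD.
  apply: (chebyshev_Ex hD); first by rewrite divr_gt0.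
  rewrite (mse hD (dot g)) refsum_gap // -/d subrr expr0n addr0.
  apply: le_trans (refsum_gap_var hD _ _ _ _) _; rewrite -/c.
  rewrite -(ler_pM2r F0).
  have p1 := ler_wpM2l (ltW NR) hcF.
  have p2 := ler_wpM2l (mulr_ge0 (ltW NR) (ltW v0)) k1.
  have p3 := ler_wpM2l (mulr_ge0 (sqr_ge0 (N%:R : R)) (ltW F0)) d2.
  have p4 : 0 <= N%:R * v by rewrite mulr_ge0 // ltW.
  by rewrite !exprS !expr0 in p1 p2 p3 *; lra.
apply: (markov_Ex hD) => //.
apply: le_trans (refsum_energy hD _ _ _ _) _; rewrite -/bb -/c.
by move: q0; rewrite /t !exprS expr0; lra.
Qed.

(** [sqdist_ideal] gives [eps ^ 2 <= n * v], which turns the conditions on [eps] into conditions on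
    [v]. The error is [3 / 40] for flattening plus [2 / 40] for the references. *)
Lemma Pr_reference_good (F N m : nat) (eps : R) a b : (0 < n)%N -> (0 < F <= n)%N ->
  (0 < N)%N -> (0 < m)%N -> 0 < eps -> eps <= dTV (D a) (D b) ->
  10 ^+ 9 * n%:R <= N%:R * F%:R * eps ^+ 2 ->
  10 ^+ 11 * n%:R ^+ 2 <= m%:R * N%:R * F%:R * eps ^+ 4 ->
  10 ^+ 11 * n%:R <= m%:R * F%:R * eps ^+ 2 ->
  Pr (reference F N a b) (fun f => ~~ classifier_good m a b f) <= 8^-1.
Proof.
move=> n0 /andP[F0 Fn] N0 m0 e0 hd k1 k2 k3.
have nR : 0 < n%:R :> R by rewrite ltr0n.
have NR : 0 < N%:R :> R by rewrite ltr0n.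
have mR : 0 < m%:R :> R by rewrite ltr0n.
have FR : 0 < F%:R :> R by rewrite ltr0n.
have e2 : 0 < eps ^+ 2 by rewrite exprn_gt0.
have hv := sqdist_ideal hD n0 Fn (ltW e0) hd.
set v := sqdist _ _ _ _ in hv.
have n2 : 0 < n%:R ^+ 2 :> R by rewrite exprn_gt0.
have v0 : 0 < v.
  have h : 0 < 3 * n%:R * v by apply: lt_le_trans hv; rewrite mulr_gt0.
  by rewrite pmulr_rgt0 ?mulr_gt0 // in h.
have ev : eps ^+ 2 <= n%:R * v by have := mulr_gt0 nR v0; lra.
have ev2 : eps ^+ 4 <= n%:R ^+ 2 * v ^+ 2.
  by rewrite -exprMn (exprM eps 2 2) lerXn2r ?nnegrE ?(ltW e2) // ltW // mulr_gt0.
rewrite (_ : 8^-1 = 3 / 40 + 2 / 40); last by lra.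
apply: (Pr_bind_le hD) (Pr_flat2_good hD F0 v0) _ => [|AB].
  by lra.
case/and3P => h1 h2 h3; rewrite /Pr Ex_pmap.
have NF0 := mulr_gt0 NR FR.
have mF0 := mulr_gt0 mR FR.
apply: (Pr_refsum_classifier_good N0 m0 FR v0 h1 h2 h3).
- rewrite -(ler_pM2l nR); have p := ler_wpM2l (ltW NF0) ev.
  by rewrite !exprS !expr0 in k1 p *; lra.
- rewrite -(ler_pM2l n2); have p := ler_wpM2l (ltW (mulr_gt0 mR NF0)) ev2.
  by rewrite !exprS !expr0 in k2 p *; lra.
- rewrite -(ler_pM2l nR); have p := ler_wpM2l (ltW mF0) ev.
  by rewrite !exprS !expr0 in k3 p *; lra.
Qed.

(** The summands are [2 * f Z - f X - f Y]: the mean of [f] under [D z] is compared with the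
    midpoint of its means under [D a] and [D b], and [true] places [z] with [a]. *)
Definition classify_test (m : nat) a b f z : prog n k bool :=
  pmap (fun T : R => 0 <= T)
    (psum m (padd (pdraw z (fun x => 2 * f x))
      (padd (pdraw a (fun x => - f x)) (pdraw b (fun x => - f x))))).

Lemma cost_classify_test m a b f z : cost_le (classify_test m a b f z) (3 * m).
Proof.
rewrite mulnC; apply: cost_pmap; apply: cost_psum.
exact: (@cost_padd _ _ _ _ _ 1 2 _ (@cost_padd _ _ _ _ _ 1 1 _ _)).
Qed.

Lemma Pr_classify_test m a b f z (ans : bool) : (0 < m)%N ->
  classifier_good m a b f -> D z = (if ans then D a else D b) ->
  Pr (classify_test m a b f z) (fun r => r != ans) <= 10^-1.
Proof.
move=> m0 /andP[H0 HG] zE.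
have mR : 0 < m%:R :> R by rewrite ltr0n.
set H := \sum_x _ in H0 HG; set G := \sum_x _ in HG.
rewrite /Pr Ex_pmap; set P := psum _ _.
pose mu : R := if ans then m%:R * H else - (m%:R * H).
have mH0 : 0 < m%:R * H by rewrite mulr_gt0.
have meanP : mean D id P = mu.
  rewrite mean_psum // !mean_padd // !mean_pdraw zE /mu /H.
  have -> : \sum_x f x * (D a x - D b x) =
      \sum_x D a x * f x + \sum_x D b x * - f x by rewrite sum_diff.
  rewrite (_ : \sum_x D b x * - f x = - \sum_x D b x * f x); last first.
    by rewrite -sumrN; apply: eq_bigr => x _; rewrite mulrN.
  rewrite (_ : \sum_x D a x * - f x = - \sum_x D a x * f x); last first.
    by rewrite -sumrN; apply: eq_bigr => x _; rewrite mulrN.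
  have two c : \sum_x D c x * (2 * f x) = 2 * \sum_x D c x * f x.
    by rewrite mulr_sumr; apply: eq_bigr => x _; ring.
  by case: (ans); rewrite two; ring.
(* The coefficient [2] contributes a factor [4] on [D z], which is [D a] or [D b]; with the two
   reference terms this makes at most [5]. *)
have varP : var D id P <= m%:R * (5 * G).
  rewrite var_psum // !var_padd // ler_wpM2l //.
  have := lerD (var_pdraw_le hD id z (fun x => 2 * f x))
     (lerD (var_pdraw_le hD id a (fun x => - f x)) (var_pdraw_le hD id b (fun x => - f x))).
  move/le_trans; apply; rewrite /G mulr_sumr -!big_split; apply: ler_sum => x _ /=.
  have := mulr_ge0 (sqr_ge0 (f x)) (D_ge0 a x).
  have := mulr_ge0 (sqr_ge0 (f x)) (D_ge0 b x).
  by rewrite zE; case: (ans); rewrite !expr2; lra.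
apply: le_trans (_ : Pr P (fun T => m%:R * H <= `|T - mu|) <= _).
  apply: le_Pr => // T; rewrite /mu; case: (ans) => /=.
    rewrite eqb_id -ltNge => T0.
    by rewrite distrC; apply: le_trans (ler_norm _); lra.
  rewrite eqbF_neg negbK => T0.
  by apply: le_trans (ler_norm _); lra.
apply: (chebyshev_Ex hD) => //.
rewrite (mse hD id) meanP subrr expr0n addr0; apply: le_trans varP _.
have := ler_wpM2l (ltW mR) HG.
by rewrite exprMn !expr2; lra.
Qed.

Fixpoint collect (test : 'I_k -> prog n k bool) (l : seq 'I_k) : prog n k {set 'I_k} :=
  if l is a :: l' then
    bind (test a) (fun r =>
      pmap (fun s : {set 'I_k} => if r then a |: s else s) (collect test l'))
  else Ret n k finset.set0.

Lemma cost_collect test l B : (forall z, cost_le (test z) B) ->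
  cost_le (collect test l) (size l * B).
Proof.
move=> ht; elim: l => [//|z l IH] /=; rewrite mulSn.
by apply: cost_bind => // r; apply: cost_pmap.
Qed.

Lemma Pr_collect test l (I : {set 'I_k}) (eta : R) : 0 <= eta ->
  (forall z, Pr (test z) (fun r => r != (z \in I)) <= eta) ->
  Pr (collect test l) (fun s => s != [set x in l | x \in I]) <= (size l)%:R * eta.
Proof.
move=> eta0 ht; elim: l => [|z l IH] /=.
  rewrite mul0r /Pr /= (_ : _ != _ = false) //.
  by apply/eqP/finset.setP => x; rewrite !inE.
rewrite -natr1 mulrDl mul1r addrC.
apply: (@Pr_bind_le _ _ _ _ hD _ _ _ _ (fun r => r == (z \in I))) => //.
  by rewrite mulr_ge0.
move=> r /eqP ->; rewrite /Pr Ex_pmap; apply: le_trans IH.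
apply: le_Pr => // s; apply: contraNN => /eqP ->; apply/eqP/finset.setP => x.
case: ifP => zI; rewrite !inE; case: eqP => [->|] //=; rewrite ?zI ?andbF //.
Qed.

End Classification.

(** * Random search for an index of the opposite cluster *)

Section Search.
Variables (R : realType) (n k : nat) (D : 'I_k.+1 -> 'I_n -> R).
Hypothesis hD : forall a, is_distr (D a).

Fixpoint search (test : 'I_k.+1 -> prog n k.+1 bool) (s : nat) : prog n k.+1 (option 'I_k.+1) :=
  if s is s'.+1 then
    PToss (fun b : 'I_k.+1 =>
      bind (test b) (fun r : bool => if r then Ret n k.+1 (Some b) else search test s'))
  else Ret n k.+1 None.

Lemma cost_search test s B : (forall z, cost_le (test z) B) ->
  cost_le (search test s) (s * B).
Proof.
move=> ht; elim: s => [//|s IH] /= b; rewrite mulSn.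
by apply: cost_bind => // -[].
Qed.

(** One more round changes the failure bound [X] into [eta + (1 - rho) * X], whose fixed point is
    [eta / rho]. Unlike a union bound over the rounds, this term does not grow with [s]. *)
Lemma Pr_search test s (opp : {set 'I_k.+1}) (eta rho : R) : 0 <= eta -> 0 < rho ->
  rho * k.+1%:R <= #|opp|%:R ->
  (forall z, Pr D (test z) (fun r => r != (z \in opp)) <= eta) ->
  Pr D (search test s) (fun o => if o is Some b then b \notin opp else true) <=
    eta / rho + (1 - rho) ^+ s.
Proof.
move=> eta0 rho0 hrho ht.
have kR : 0 < k.+1%:R :> R by rewrite ltr0n.
have rho1 : rho <= 1.
  rewrite -(ler_pM2r kR) mul1r; apply: le_trans hrho _; rewrite ler_nat.
  by rewrite -[leqRHS]card_ord max_card.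
elim: s => [|s IH] /=; first by rewrite expr0 /Pr /= lerDr divr_ge0 // ltW.
set bad := fun o : option _ => _ in IH *.
set X := Pr D (search test s) bad in IH.
have X0 : 0 <= X by apply: Pr_ge0.
have X1 : X <= 1 by apply: Pr_le1.
(* A candidate in [opp] fails only through a wrong answer; any other one, if answered correctly,
   passes on to the remaining rounds. *)
have step b : Ex D (bind (test b) (fun r : bool =>
      if r then Ret n k.+1 (Some b) else search test s))
    (fun o => (bad o)%:R) <= eta + X * (b \notin opp)%:R.
  rewrite Ex_bind.
  apply: le_trans (_ : Ex D (test b) (fun r => (r != (b \in opp))%:R + X * (b \notin opp)%:R) <= _).
    apply: le_Ex => // r; case: r; case: (boolP (b \in opp)) => hb //=.
    - by rewrite /bad hb mulr0 addr0.
    - by rewrite /bad hb mulr1 lerDl.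
    - by rewrite mulr0 addr0.
    - by rewrite mulr1 add0r.
  by rewrite ExD Ex_cst // lerD2r; exact: ht.
rewrite /Pr /= -/bad mulrC ler_pdivrMr //.
apply: le_trans (ler_sum _ (fun b _ => step b)) _.
rewrite big_split /= sumr_const card_ord -mulr_sumr.
have -> : \sum_(b < k.+1) (b \notin opp)%:R = k.+1%:R - #|opp|%:R :> R.
  apply/eqP; rewrite eq_sym subr_eq; apply/eqP.
  transitivity (\sum_(b < k.+1) (1 : R)); first by rewrite sumr_const card_ord.
  rewrite -sum1_card natr_sum [X in _ = _ + X]big_mkcond -big_split /=.
  apply: eq_bigr => b _.
  by case: (b \in opp); rewrite ?addr0 ?add0r.
have h1 : X * (k.+1%:R - #|opp|%:R) <= X * ((1 - rho) * k.+1%:R).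
  by rewrite ler_wpM2l //; lra.
have h2 : X * (1 - rho) <= (eta / rho + (1 - rho) ^+ s) * (1 - rho).
  by rewrite ler_wpM2r //; lra.
have h3 := ler_wpM2r (ltW kR) h2.
have : (eta / rho + (1 - rho) ^+ s) * (1 - rho) = eta / rho + (1 - rho) ^+ s.+1 - eta.
  by rewrite exprS; field; rewrite gt_eqF.
by move=> e3; rewrite e3 in h3; rewrite -mulr_natr; lra.
Qed.

End Search.

(** * The complete algorithm and its error *)

Section Clustering.
Variables (R : realType) (n k : nat).

Definition cluster (s L F1 m1 F2 N m2 : nat) (tau : R) : prog n k.+1 {set 'I_k.+1} :=
  bind (counts n F1 ord0) (fun A =>
    bind (search (fun b =>
            majority L (closeness_test (flatten1 R A) m1 tau ord0 b)) s) (fun o =>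
      if o is Some b then
        bind (reference R n F2 N ord0 b) (fun f =>
          collect (fun z => majority L (classify_test m2 ord0 b f z)) (enum 'I_k.+1))
      else Ret n k.+1 finset.set0)).

Lemma cost_cluster s L F1 m1 F2 N m2 tau :
  cost_le (cluster s L F1 m1 F2 N m2 tau)
    (F1 + (s * (L * (4 * m1)) + ((2 * F2 + 2 * N) + k.+1 * (L * (3 * m2))))).
Proof.
apply: cost_bind => [|A]; first exact: cost_counts.
apply: cost_bind => [|[b|] //].
  by apply: cost_search => b; apply: cost_majority; apply: cost_closeness_test.
apply: cost_bind => [|f]; first exact: cost_reference.
have hz z : cost_le (majority L (classify_test m2 ord0 b f z)) (L * (3 * m2)).
  by apply: cost_majority; apply: cost_classify_test.
by have := cost_collect (enum 'I_k.+1) hz; rewrite size_enum_ord.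
Qed.

Lemma dTVC (p q : 'I_n -> R) : dTV p q = dTV q p.
Proof. by rewrite /dTV; congr (_ * _); apply: eq_bigr => x _; rewrite distrC. Qed.

Variables (s L F1 m1 F2 N m2 r : nat) (eps : R).
Hypotheses (n0 : (0 < n)%N) (e0 : 0 < eps).
Hypotheses (F1n : (0 < F1 <= n)%N) (F2n : (0 < F2 <= n)%N).
Hypotheses (m10 : (0 < m1)%N) (m20 : (0 < m2)%N) (N0 : (0 < N)%N).
Hypotheses (r0 : (0 < r)%N) (rk : (r <= k.+1)%N).
Hypothesis hL : (3 / 5) ^+ L * (128 * k.+1%:R) <= 1 :> R.
Hypothesis hs : 20 * k.+1%:R <= s%:R * r%:R :> R.
Hypothesis h1 : (4 * 10 ^+ 8) * n%:R ^+ 2 <= m1%:R ^+ 2 * F1%:R * eps ^+ 4.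
Hypothesis h2 : (4 * 10 ^+ 8) * n%:R <= m1%:R ^+ 2 * eps ^+ 2.
Hypothesis h3 : 10 ^+ 9 * n%:R <= N%:R * F2%:R * eps ^+ 2.
Hypothesis h4 : 10 ^+ 11 * n%:R ^+ 2 <= m2%:R * N%:R * F2%:R * eps ^+ 4.
Hypothesis h5 : 10 ^+ 11 * n%:R <= m2%:R * F2%:R * eps ^+ 2.

(** The errors add up to at most [1 / 3]: [1 / 10] for the first flattening, [1 / 128 + 1 / 21] for
    the search, [1 / 8] for the references and [1 / 128] for the classification. *)
Lemma cluster_correct (D : 'I_k.+1 -> 'I_n -> R) (I1 : {set 'I_k.+1}) :
  clustering_instance eps D I1 -> r = minn #|I1| #|~: I1| ->
  2 / 3 <= prob_output D (correct_output I1)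
    (to_alg (cluster s L F1 m1 F2 N m2 (m1%:R ^+ 2 * eps ^+ 2 / (20 * n%:R)))).
Proof.
case=> hD _ _ same far rE.
have kR : 0 < k.+1%:R :> R by rewrite ltr0n.
have nR : 0 < n%:R :> R by rewrite ltr0n.
have rR : 0 < r%:R :> R by rewrite ltr0n.
pose opp : {set 'I_k.+1} := if ord0 \in I1 then ~: I1 else I1.
have oppE b : (b \in opp) = ((b \in I1) != (ord0 \in I1)).
  by rewrite /opp; case: (ord0 \in I1); rewrite ?inE; case: (b \in I1).
have ropp : (r <= #|opp|)%N.
  by rewrite rE /opp; case: (_ \in _); rewrite geq_min leqnn ?orbT.
have sameD b : b \notin opp -> D b = D ord0.
  by rewrite oppE negbK => /eqP hb; apply: same.
have sameO b z : b \in opp -> z \in opp -> D z = D b.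
  rewrite !oppE => hb hz; apply: same.
  by move: hb hz; case: (b \in I1); case: (z \in I1); case: (ord0 \in I1).
have farD b : b \in opp -> eps <= dTV (D ord0) (D b).
  rewrite oppE; case: (boolP (ord0 \in I1)) => h0; case: (boolP (b \in I1)) => hb // _.
    exact: far.
  by rewrite dTVC; apply: far.
set P := cluster _ _ _ _ _ _ _ _.
rewrite prob_output_to_alg.
suff : Pr D P (fun S => ~~ correct_output I1 S) <= 3^-1.
  by rewrite PrC // /Pr; lra.
pose eta : R := (3 / 5) ^+ L.
have eta0 : 0 <= eta by rewrite exprn_ge0 // divr_ge0.
have hk : k.+1%:R * eta <= 128^-1.
  by move: hL; rewrite -/eta; lra.
pose rho : R := r%:R / k.+1%:R.
have rho0 : 0 < rho by rewrite divr_gt0.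
have rho1 : rho <= 1 by rewrite ler_pdivrMr // mul1r ler_nat.
have hrho : eta / rho <= 128^-1.
  rewrite /rho invf_div mulrA [eta * _]mulrC ler_pdivrMr //; apply: le_trans hk _.
  by rewrite ler_peMr ?invr_ge0 // ler1n.
have hs' : 20 <= s%:R * rho.
  by rewrite /rho mulrA ler_pdivlMr.
(* Bernoulli's inequality in the form [(1 - rho) ^ s * (1 + s * rho) <= 1], with [s * rho >= 20]. *)
have hpow : (1 - rho) ^+ s <= 21^-1.
  have sg : (1 - rho) ^+ s * (1 + s%:R * rho) <= 1.
    elim: (s) => [|j IH]; first by rewrite expr0 mul0r addr0 mulr1.
    apply: le_trans IH; rewrite exprS -mulrA [_ ^+ j * _]mulrC mulrA mulrC.
    rewrite ler_wpM2l ?exprn_ge0 ?subr_ge0 // -natr1.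
    have := mulr_ge0 (ler0n R j) (sqr_ge0 rho); have := sqr_ge0 rho.
    by rewrite !expr2; lra.
  have p0 : 0 <= (1 - rho) ^+ s by rewrite exprn_ge0 // subr_ge0.
  have := ler_wpM2l p0 hs'; lra.
have fin : 10^-1 + (eta / rho + (1 - rho) ^+ s + (8^-1 + k.+1%:R * eta)) <= 3^-1.
  by lra.
apply: le_trans fin.
have keta0 : 0 <= k.+1%:R * eta by rewrite mulr_ge0.
apply: (Pr_bind_le hD _ (Pr_flat1_good hD ord0 n0 F1n)) => [|A].
  by rewrite !addr_ge0 ?divr_ge0 ?exprn_ge0 ?subr_ge0 ?invr_ge0 // ltW.
case/andP=> hA1 hA2.
have w01 x : 0 <= flatten1 R A x <= 1 by apply: inv_natS_itv.
have F10 : (0 < F1)%N by case/andP: F1n.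
pose good (o : option 'I_k.+1) := if o is Some b then b \in opp else false.
apply: (@Pr_bind_le _ _ _ _ hD _ _ _ _ good) => [||o].
- by rewrite addr_ge0 // invr_ge0.
- rewrite (_ : (fun x => ~~ good x) =
      fun o : option 'I_k.+1 => if o is Some b then b \notin opp else true); last first.
    by apply: funext => -[].
  apply: Pr_search => // [|b].
    by rewrite /rho divfK ?gt_eqF // ler_nat.
  apply: Pr_majority => //; case: (boolP (b \in opp)) => hb.
    rewrite (_ : (fun b0 => b0 != true) = negb); last by apply: funext => -[].
    apply: (@closeness_test_diff _ _ _ _ hD _ _ F1) => //.
    rewrite ler_pdivrMr ?mulr_gt0 //.
    have wpos x : 0 < flatten1 R A x by rewrite invr_gt0 ltr0n.
    have hS : \sum_x (flatten1 R A x)^-1 <= 40 * n%:R.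
      by apply: le_trans hA2; apply: ler_sum => x _; rewrite /flatten1 invrK.
    have := sqdist_ge (ltW e0) wpos hS (farD _ hb).
    by lra.
  rewrite (_ : (fun b0 => b0 != false) = id); last by apply: funext => -[].
  by apply: (@closeness_test_same _ _ _ _ hD _ _ F1) => //; rewrite sameD.
- case: o => [b|] //= hb.
  apply: (Pr_bind_le hD keta0
    (Pr_reference_good hD n0 F2n N0 m20 e0 (farD _ hb) h3 h4 h5)) => f hf.
  (* The collected set should be the cluster of index [0], which is [I1] or its complement; both are
     correct outputs. *)
  apply: le_trans (_ : Pr D (collect (fun z => majority L (classify_test m2 ord0 b f z))
      (enum 'I_k.+1)) (fun S => S != [set x in enum 'I_k.+1 | x \in ~: opp]%SET) <= _).
    apply: le_Pr => // S; apply: contraNN => /eqP ->; rewrite /correct_output.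
    rewrite (_ : [set x in _ | _]%SET = ~: opp); last first.
      by apply/finset.setP => x; rewrite !inE mem_enum.
    by rewrite /opp; case: (_ \in _); rewrite ?finset.setCK eqxx ?orbT.
  rewrite (_ : k.+1%:R = (size (enum 'I_k.+1))%:R); last by rewrite size_enum_ord.
  apply: Pr_collect => // z.
  apply: Pr_majority => //; apply: Pr_classify_test => //.
  rewrite inE; case: (boolP (z \in opp)) => hz /=; first exact: sameO.
  exact: sameD.
Qed.

End Clustering.

(** * Number of repetitions and the bounds behind the sample sizes *)

Section SampleSizes.
Variable R : realType.

(** [ln (1 + x) <= x] at [x = - 1 / 2]. *)
Lemma ln2_ge : 2^-1 <= ln 2 :> R.
Proof.
have := @le_ln1Dx R (- 2^-1) ltac:(lra).
rewrite (_ : 1 - 2^-1 = 2^-1); last by lra.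
by rewrite lnV ?posrE //; lra.
Qed.

Lemma ln_nat_ge (k : nat) : (2 <= k)%N -> (trunc_log 2 k)%:R / 2 <= ln k%:R :> R.
Proof.
move=> k2; have /andP[h _] := @trunc_log_bounds 2 k isT (ltnW k2).
set j := trunc_log 2 k in h *.
apply: le_trans (_ : ln ((2 : R) ^+ j) <= _); last first.
  by rewrite ler_ln ?posrE ?exprn_gt0 ?ltr0n ?(ltnW k2) // -natrX ler_nat.
rewrite lnXn // -[leRHS]mulr_natl ler_wpM2l //; exact: ln2_ge.
Qed.

Lemma trunc_log2_gt0 (k : nat) : (2 <= k)%N -> (0 < trunc_log 2 k)%N.
Proof. by move=> k2; rewrite trunc_log_gt0. Qed.

(** Two votes multiply the majority error by [9 / 25], less than [1 / 2], so [8 + trunc_log 2 k]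
    pairs beat the factor [128 * k]. *)
Definition rounds (k : nat) : nat := (2 * (8 + trunc_log 2 k))%N.

Lemma rounds_le (k : nat) : (2 <= k)%N -> (rounds k)%:R <= 36 * ln k%:R :> R.
Proof.
move=> k2; have h := ln_nat_ge k2.
have : 1 <= (trunc_log 2 k)%:R :> R by rewrite ler1n trunc_log2_gt0.
by rewrite /rounds natrM natrD; lra.
Qed.

Lemma rounds_error (k : nat) : (0 < k)%N ->
  (3 / 5) ^+ rounds k * (128 * k%:R) <= 1 :> R.
Proof.
move=> k0; have /andP[_ h] := @trunc_log_bounds 2 k isT k0.
rewrite /rounds exprM; set j := trunc_log 2 k in h *.
apply: le_trans (_ : 2^-1 ^+ (8 + j) * 2 ^+ (8 + j) <= _); last first.
  by rewrite -exprMn mulVf // expr1n.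
apply: ler_pM; rewrite ?exprn_ge0 ?mulr_ge0 //; try lra.
  by apply: lerXn2r; rewrite ?nnegrE ?sqr_ge0 //; rewrite ?expr2; lra.
rewrite (_ : 8 + j = 7 + j.+1)%N; last by lia.
rewrite exprD (_ : 128 = 2 ^+ 7); last by ring.
by rewrite ler_wpM2l ?exprn_ge0 // -natrX ler_nat ltnW.
Qed.

Lemma ler_of_expr (x y : R) (j : nat) : (0 < j)%N -> 0 <= x -> 0 <= y ->
  x ^+ j <= y ^+ j -> x <= y.
Proof. by move=> j0 x0 y0; rewrite ler_pXn2r. Qed.

Lemma powR_frac (y : R) (i j : nat) : (0 < j)%N -> 0 <= y ->
  (y `^ (i%:R / j%:R)) ^+ j = y ^+ i.
Proof.
move=> j0 y0; rewrite -powR_mulrn ?powR_ge0 // -powRrM divfK ?powR_mulrn //.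
by rewrite pnatr_eq0 -lt0n.
Qed.

(** These are the size conditions of the classification, up to constants, for about [T] reference
    samples, [T / l] test samples and [min n T] flattening samples. The three regimes of [R_term]
    are the ways of making one of them tight. *)
Lemma R_term_facts (n k : nat) (eps : R) (l := k%:R * ln k%:R) (T := R_term n k eps) :
  (0 < n)%N -> 0 < l -> 0 < eps -> eps <= 1 ->
  [/\ l <= T, l * n%:R ^+ 2 <= T ^+ 2 * Num.min n%:R T * eps ^+ 4
    & l * n%:R <= T * Num.min n%:R T * eps ^+ 2].
Proof.
move=> n0 l0 e0 e1.
have nR : 0 < n%:R :> R by rewrite ltr0n.
have e2 : 0 < eps ^+ 2 by rewrite exprn_gt0.
have e4 : 0 < eps ^+ 4 by rewrite exprn_gt0.
have e21 : eps ^+ 2 <= 1 by rewrite exprn_ile1 // ltW.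
have e41 : eps ^+ 4 <= 1 by rewrite exprn_ile1 // ltW.
have l2 : 0 <= l ^+ 2 by apply: sqr_ge0.
rewrite /T /R_term -/l {T}; clearbody l; case: ifP => [hn|hn]; last case: ifP => [ln|ln].
(* Large [n]: here [T <= n] and the second bound is the equality [T ^ 3 * eps ^ 4 = n ^ 2 * l]. *)
- move: hn; rewrite ler_pdivrMr // => hn.
  set T := powR _ _.
  have y0 : 0 <= n%:R ^+ 2 * l / eps ^+ 4 by rewrite divr_ge0 ?(ltW e4) // mulr_ge0 ?sqr_ge0 // ltW.
  have T3 : T ^+ 3 * eps ^+ 4 = n%:R ^+ 2 * l.
    by rewrite /T (@powR_frac _ 1 3) // expr1 divfK // gt_eqF.
  have T0 : 0 <= T by apply: powR_ge0.
  have lnn : l <= n%:R by apply: le_trans hn _; rewrite ler_piMr // ltW.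
  have Tn : T <= n%:R.
    apply: (@ler_of_expr _ _ 3) => //; rewrite -(ler_pM2r e4) T3 [n%:R ^+ 3]exprSr -[leRHS]mulrA.
    by rewrite ler_wpM2l // sqr_ge0.
  have Tp : 0 < T.
    rewrite lt0r T0 andbT; apply/eqP => Tz; move: T3; rewrite Tz expr0n mul0r => /esym/eqP.
    by rewrite gt_eqF // mulr_gt0 // exprn_gt0.
  rewrite (min_idPr Tn); split.
  + apply: (@ler_of_expr _ _ 3) => //; first exact: ltW.
    apply: le_trans (_ : T ^+ 3 * eps ^+ 4 <= _); last first.
      by rewrite ler_piMr // exprn_ge0.
    rewrite T3 [l ^+ 3]exprSr ler_wpM2r ?(ltW l0) // lerXn2r ?nnegrE //; exact: ltW.
  + by rewrite -exprSr T3 mulrC.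
  + have c0 : 0 < T * eps ^+ 2 by rewrite mulr_gt0.
    rewrite -(ler_pM2r c0).
    rewrite [leRHS](_ : _ = T ^+ 3 * eps ^+ 4); last by ring.
    rewrite T3 (_ : n%:R ^+ 2 * l = l * n%:R * n%:R); last by ring.
    rewrite ler_wpM2l ?mulr_ge0 ?(ltW l0) //; apply: le_trans Tn.
    by rewrite ler_piMr.
(* Middle regime: [n <= T], and the second bound is an equality because
   [T ^ 2 * eps ^ 4 = n * l]. *)
- move/negbT: hn; rewrite -ltNge ltr_pdivlMr // => hn.
  set T := _ / _; have T0 : 0 <= T by rewrite divr_ge0 ?sqrtr_ge0 // ltW.
  have Te : T * eps ^+ 2 = Num.sqrt (n%:R * l) by rewrite divfK // gt_eqF.
  have T2 : T ^+ 2 * eps ^+ 4 = n%:R * l.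
    rewrite (_ : _ * _ = (T * eps ^+ 2) ^+ 2); last by ring.
    by rewrite Te sqr_sqrtr // mulr_ge0 ?(ltW l0).
  have lTe : l <= T * eps ^+ 2.
    rewrite Te -[l in leLHS]gtr0_norm // -sqrtr_sqr ler_wsqrtr // expr2.
    by rewrite ler_wpM2r // ltW.
  have nT : n%:R <= T.
    apply: (@ler_of_expr _ _ 2) => //; rewrite -(ler_pM2r e4) T2 expr2 -[leLHS]mulrA.
    by rewrite ler_wpM2l // ltW.
  rewrite (min_idPl nT); split.
  + by apply: le_trans lTe _; rewrite ler_piMr.
  + by rewrite mulrAC T2; rewrite expr2; lra.
  + by rewrite mulrAC ler_wpM2r.
(* Small [n]: again [n <= T], and [T * eps ^ 2 = l] makes the third bound an equality. *)
- move/negbT: ln; rewrite -ltNge => nl.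
  set T := _ / _; have T0 : 0 < T by rewrite divr_gt0.
  have Te : T * eps ^+ 2 = l by rewrite divfK // gt_eqF.
  have lT : l <= T by rewrite -Te ler_piMr // ltW.
  rewrite (min_idPl (le_trans (ltW nl) lT)); split => //.
  + rewrite [leRHS](_ : _ = (T * eps ^+ 2) ^+ 2 * n%:R); last by ring.
    rewrite Te !expr2 -!mulrA ler_wpM2l ?(ltW l0) //.
    by rewrite ler_wpM2r // ltW.
  + by rewrite mulrAC Te.
Qed.

(** The same for the search, with about [M / kap] samples per comparison. The power [2 / 3] in the
    maximum gives the second bound when [M <= n]; the square root gives the other two. *)
Lemma M_term_facts (n k r : nat) (eps : R) (kap := k%:R / r%:R) (T := M_term n k r eps) :
  (0 < n)%N -> (0 < r)%N -> 0 < eps -> eps <= 1 ->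
  [/\ kap <= T, kap ^+ 2 * n%:R ^+ 2 <= T ^+ 2 * Num.min n%:R T * eps ^+ 4
    & kap ^+ 2 * n%:R <= T ^+ 2 * eps ^+ 4].
Proof.
move=> n0 r0 e0 e1.
have nR : 0 < n%:R :> R by rewrite ltr0n.
have rR : 0 < r%:R :> R by rewrite ltr0n.
have e2 : 0 < eps ^+ 2 by rewrite exprn_gt0.
have e4 : 0 < eps ^+ 4 by rewrite exprn_gt0.
have e21 : eps ^+ 2 <= 1 by rewrite exprn_ile1 // ltW.
have kap0 : 0 <= kap by rewrite divr_ge0.
have hA : powR (n%:R * k%:R / (r%:R * eps ^+ 2)) (2 / 3) <= T by rewrite le_max lexx.
have hB : k%:R * Num.sqrt n%:R / (r%:R * eps ^+ 2) <= T by rewrite le_max lexx orbT.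
have T0 : 0 <= T by apply: le_trans hA; apply: powR_ge0.
have hB' : kap * Num.sqrt n%:R <= T * eps ^+ 2.
  rewrite -ler_pdivrMr //; apply: le_trans hB; rewrite le_eqVlt; apply/orP; left.
  by apply/eqP; rewrite /kap; field; rewrite !gt_eqF.
have third : kap ^+ 2 * n%:R <= T ^+ 2 * eps ^+ 4.
  rewrite (_ : _ * eps ^+ 4 = (T * eps ^+ 2) ^+ 2); last by ring.
  rewrite -[n%:R](@sqr_sqrtr R) ?ler0n // -exprMn.
  by rewrite lerXn2r ?nnegrE ?mulr_ge0 ?sqrtr_ge0 ?(ltW e0).
have hA' : kap ^+ 2 * n%:R ^+ 2 <= T ^+ 3 * eps ^+ 4.
  have y0 : 0 <= n%:R * k%:R / (r%:R * eps ^+ 2) :> R by rewrite divr_ge0 ?mulr_ge0 // ltW.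
  have h3 : (n%:R * k%:R / (r%:R * eps ^+ 2)) ^+ 2 <= T ^+ 3.
    by rewrite -(@powR_frac _ 2 3 isT y0) lerXn2r ?nnegrE ?powR_ge0.
  have := ler_wpM2r (ltW e4) h3; apply: le_trans.
  rewrite le_eqVlt; apply/orP; left; apply/eqP; rewrite /kap; field.
  by rewrite !gt_eqF.
split => //.
- have s1 : 1 <= Num.sqrt n%:R :> R.
    by rewrite -[1 in leLHS]sqrtr1 ler_wsqrtr // ler1n.
  apply: le_trans (_ : kap * Num.sqrt n%:R <= _); first by rewrite ler_peMr.
  by apply: le_trans hB' _; rewrite ler_piMr.
- case: (leP n%:R T) => _; last by rewrite -exprSr.
  by have := ler_wpM2r (ltW nR) third; rewrite expr2; lra.
Qed.

(* At most one above the ceiling: [ceilS x = x + 1] when [x] is a natural number. *)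
Definition ceilS (x : R) : nat := (Num.truncn x).+1.

Lemma ceilS_ge x : x <= (ceilS x)%:R.
Proof. by apply: ltW; apply: truncnS_gt. Qed.

Lemma ceilS_le x : 0 <= x -> (ceilS x)%:R <= x + 1.
Proof. by move=> x0; rewrite -natr1 lerD2r; case/andP: (truncn_itv x0). Qed.

End SampleSizes.

(** Here [x] stands for [s * m1 * L], [y] for [N] and [z] for [k * m2 * L]. The largest constant,
    about [108 * 10 ^ 11], comes from the classification. *)
Lemma sample_budget (R : realType) (f1 x f2 y z M lnk T : R) :
  f1 <= M + 1 -> 1 <= M -> M <= 2 * (M * lnk) ->
  x <= 21 * ((2 * 10 ^+ 4 + 1) * M) * (36 * lnk) ->
  f2 <= T + 1 -> 1 <= T -> y <= 10 ^+ 9 * T + 1 ->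
  z <= 36 * ((10 ^+ 11 + 1) * T) ->
  f1 + (4 * x + ((2 * f2 + 2 * y) + 3 * z)) <= 10 ^+ 14 * (M * lnk + T).
Proof. by rewrite !exprS !expr0; lra. Qed.

(** * Choice of the parameters and the total number of samples *)

Theorem theoremC3 (R : realType) :
  exists C : R, 0 < C /\
  forall (n k r : nat) (eps : R),
    (0 < n)%N -> (2 <= k)%N -> 0 < eps -> eps <= 1 ->
    exists (t : alg n k) (B : nat),
      uses_at_most t B /\
      B%:R <= C * (M_term n k r eps * ln k%:R + R_term n k eps) /\
      forall (D : 'I_k -> 'I_n -> R) (I1 : {set 'I_k}),
        clustering_instance eps D I1 ->
        r = minn #|I1| #|~: I1| ->
        2 / 3 <= prob_output D (correct_output I1) t.
Proof.
exists (10 ^+ 14); split; first by rewrite exprn_gt0.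
move=> n [//|k'] r eps n0; set k := k'.+1 => k2 e0 e1.
have nR : 0 < n%:R :> R by rewrite ltr0n.
have kR : 0 < k%:R :> R by rewrite ltr0n (ltnW k2).
have lnk : 2^-1 <= ln k%:R :> R.
  apply: le_trans (ln_nat_ge R k2); rewrite -[leLHS]mul1r ler_wpM2r ?invr_ge0 //.
  by rewrite ler1n trunc_log2_gt0.
pose l : R := k%:R * ln k%:R.
have l1 : 1 <= l.
  have : 2 <= k%:R :> R by rewrite ler_nat.
  by move=> h; have := ler_pM (ler0n R 2) (ltac:(lra) : 0 <= 2^-1 :> R) h lnk; rewrite /l; lra.
have l0 : 0 < l by lra.
have [Rl R2 R1] := R_term_facts n0 l0 e0 e1.
rewrite -/l in Rl R2 R1.
set T := R_term n k eps in Rl R2 R1 *.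
set M := M_term n k r eps.
have M0 : 0 <= M by rewrite /M /M_term le_max powR_ge0.
(* No instance has a smaller cluster of size [0] or above [k], so for such [r] any algorithm is
   correct. *)
have [rbad|] := boolP ((r == 0) || (k < r))%N.
  exists (Out finset.set0), 0%N; split; first by constructor.
  split.
    by rewrite mulr_ge0 ?exprn_ge0 // addr_ge0 ?mulr_ge0 //; lra.
  move=> D I1 [_ I1n I1c _ _] rE; move: rbad; rewrite rE -leqn0 leqNgt.
  rewrite leq_min !card_gt0 I1n I1c /= ltnNge geq_min.
  by have := max_card (mem I1); rewrite card_ord => ->.
rewrite negb_or -lt0n -leqNgt => /andP[r0 rk].
have rR : 0 < r%:R :> R by rewrite ltr0n.
have [Mk M2 M1] := M_term_facts k n0 r0 e0 e1.
set kap := k%:R / r%:R in Mk M2 M1; rewrite -/M in Mk M2 M1.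
have kap1 : 1 <= kap by rewrite ler_pdivlMr // mul1r ler_nat.
have kap0 : 0 < kap by lra.
have M0' : 0 < M by lra.
have T0 : 0 < T by lra.
(* The constants stay opaque until the end, so that arithmetic treats them as atoms. [K ^ 2] is the
   [4 * 10 ^ 8] of the closeness test. *)
have [K KE] : exists K : R, K = 2 * 10 ^+ 4 by eexists.
have [K9 K9E] : exists K : R, K = 10 ^+ 9 by eexists.
have [K11 K11E] : exists K : R, K = 10 ^+ 11 by eexists.
have c9 : 0 <= K9 by rewrite K9E exprn_ge0.
have c9' : 1 <= K9 by rewrite K9E exprn_ege1 // ler1n.
have c11 : 0 <= K11 by rewrite K11E exprn_ge0.
have K0 : 0 < K by rewrite KE mulr_gt0 ?exprn_gt0.
(* Up to constants and the [L] repetitions, [kap] comparisons cost [M / kap] each and [k]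
   classifications [T / l] each. Flattening samples are capped at [n], as [Pr_flat1_good] and
   [sqdist_ideal] require. *)
pose s := ceilS (20 * kap).
pose L := rounds k.
pose F1 := minn n (ceilS M).
pose m1 := ceilS (K * M / kap).
pose F2 := minn n (ceilS T).
pose N := ceilS (K9 * T).
pose m2 := ceilS (K11 * T / l).
have F1n : (0 < F1 <= n)%N by rewrite leq_min n0 geq_minl.
have F2n : (0 < F2 <= n)%N by rewrite leq_min n0 geq_minl.
have minE (x : R) : Num.min n%:R x <= (minn n (ceilS x))%:R.
  rewrite /minn; case: ifP => _; rewrite ge_min ?lexx //.
  by rewrite ceilS_ge orbT.
have F1ge : Num.min n%:R M <= F1%:R by apply: minE.
have F2ge : Num.min n%:R T <= F2%:R by apply: minE.
have F1le : F1%:R <= M + 1.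
  by apply: le_trans (ceilS_le M0); rewrite ler_nat geq_minr.
have F2le : F2%:R <= T + 1.
  by apply: le_trans (ceilS_le (ltW T0)); rewrite ler_nat geq_minr.
have e2 : 0 < eps ^+ 2 by rewrite exprn_gt0.
have e4 : 0 < eps ^+ 4 by rewrite exprn_gt0.
have e21 : eps ^+ 2 <= 1 by rewrite exprn_ile1 // ltW.
have m1ge : K * M <= m1%:R * kap by rewrite -ler_pdivrMr // ceilS_ge.
have m2ge : K11 * T <= m2%:R * l by rewrite -ler_pdivrMr // ceilS_ge.
have Nge : K9 * T <= N%:R by apply: ceilS_ge.
have minT0 : 0 <= Num.min n%:R T by rewrite le_min (ltW nR) ltW.
have minM0 : 0 <= Num.min n%:R M by rewrite le_min (ltW nR) ltW.
have kap2 : 0 < kap ^+ 2 by rewrite exprn_gt0.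
have m1sq : K ^+ 2 * M ^+ 2 <= m1%:R ^+ 2 * kap ^+ 2.
  by rewrite -!exprMn lerXn2r ?nnegrE // mulr_ge0 // ltW.
have K2E : K ^+ 2 = 4 * 10 ^+ 8 by rewrite KE; ring.
(* Multiplying by [kap ^ 2], and by [l] in the later bounds on [m2], clears the denominator of the
   sample size. *)
have p1 : K ^+ 2 * n%:R ^+ 2 <= m1%:R ^+ 2 * F1%:R * eps ^+ 4.
  rewrite -(ler_pM2r kap2).
  apply: le_trans (_ : K ^+ 2 * M ^+ 2 * (Num.min n%:R M * eps ^+ 4) <= _).
    by have := ler_wpM2l (sqr_ge0 K) M2; lra.
  apply: le_trans (_ : m1%:R ^+ 2 * kap ^+ 2 * (F1%:R * eps ^+ 4) <= _); last by lra.
  apply: ler_pM => //; rewrite ?mulr_ge0 ?(ltW K0) ?(ltW e0) ?(ltW e4) //.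
  by rewrite ler_wpM2r // ltW.
have p2 : K ^+ 2 * n%:R <= m1%:R ^+ 2 * eps ^+ 2.
  rewrite -(ler_pM2r kap2).
  apply: le_trans (_ : K ^+ 2 * M ^+ 2 * eps ^+ 4 <= _).
    by have := ler_wpM2l (sqr_ge0 K) M1; lra.
  apply: le_trans (_ : m1%:R ^+ 2 * kap ^+ 2 * eps ^+ 2 <= _); last by lra.
  apply: ler_pM => //; rewrite ?mulr_ge0 ?(ltW K0) ?(ltW e0) ?(ltW e4) //.
  by rewrite (exprD eps 2 2) ler_piMr // ltW.
have T1 : n%:R <= T * Num.min n%:R T * eps ^+ 2.
  by apply: le_trans R1; rewrite ler_peMl.
have p3 : K9 * n%:R <= N%:R * F2%:R * eps ^+ 2.
  apply: le_trans (ler_wpM2l c9 T1) _.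
  rewrite mulrA ler_wpM2r ?(ltW e2) // mulrA.
  by apply: ler_pM; rewrite // mulr_ge0 // ltW.
have TN : T <= N%:R.
  by apply: le_trans Nge; rewrite ler_peMl ?(ltW T0).
have p4 : K11 * n%:R ^+ 2 <= m2%:R * N%:R * F2%:R * eps ^+ 4.
  rewrite -(ler_pM2r l0).
  apply: le_trans (_ : (K11 * T) * (T * (Num.min n%:R T * eps ^+ 4)) <= _).
    by have := ler_wpM2l c11 R2; lra.
  apply: le_trans (_ : (m2%:R * l) * (N%:R * (F2%:R * eps ^+ 4)) <= _); last by lra.
  apply: ler_pM => //; rewrite ?mulr_ge0 ?(ltW T0) ?(ltW e0) ?(ltW e4) //.
  apply: ler_pM => //; rewrite ?mulr_ge0 ?(ltW T0) ?(ltW e0) ?(ltW e4) //.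
  by rewrite ler_wpM2r // ltW.
have p5 : K11 * n%:R <= m2%:R * F2%:R * eps ^+ 2.
  rewrite -(ler_pM2r l0).
  apply: le_trans (_ : (K11 * T) * (Num.min n%:R T * eps ^+ 2) <= _).
    by have := ler_wpM2l c11 R1; lra.
  apply: le_trans (_ : (m2%:R * l) * (F2%:R * eps ^+ 2) <= _); last by lra.
  apply: ler_pM => //; rewrite ?mulr_ge0 ?(ltW T0) ?(ltW e0) //.
  by rewrite ler_wpM2r // ltW.
have hs : 20 * k%:R <= s%:R * r%:R :> R.
  by rewrite -ler_pdivrMr // -mulrA ceilS_ge.
have Lle : L%:R <= 36 * ln k%:R :> R by apply: rounds_le.
have hL : (3 / 5) ^+ L * (128 * k%:R) <= 1 :> R by apply: rounds_error; apply: ltnW.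
pose B := (F1 + (s * (L * (4 * m1)) + ((2 * F2 + 2 * N) + k * (L * (3 * m2)))))%N.
have hB : B%:R <= 10 ^+ 14 * (M * ln k%:R + T).
  have sle : s%:R <= 21 * kap.
    apply: le_trans (ceilS_le _) _; last by lra.
    by rewrite mulr_ge0 // ltW.
  (* The unit added by [ceilS] is absorbed because [kap <= M]; below, [l <= T] does the same for
     [m2]. *)
  have m1le : m1%:R * kap <= (K + 1) * M.
    apply: le_trans (_ : (K * M / kap + 1) * kap <= _).
      apply: ler_wpM2r (ltW kap0) _ _ _; apply: ceilS_le.
      exact: divr_ge0 (mulr_ge0 (ltW K0) M0) (ltW kap0).
    by rewrite mulrDl divfK ?gt_eqF // mul1r; lra.
  have m2le : m2%:R * l <= (K11 + 1) * T.
    apply: le_trans (_ : (K11 * T / l + 1) * l <= _).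
      apply: ler_wpM2r (ltW l0) _ _ _; apply: ceilS_le.
      exact: divr_ge0 (mulr_ge0 c11 (ltW T0)) (ltW l0).
    by rewrite mulrDl divfK ?gt_eqF // mul1r; lra.
  have Nle : N%:R <= K9 * T + 1.
    by apply: ceilS_le; rewrite mulr_ge0 // ltW.
  have sm : s%:R * m1%:R <= 21 * ((K + 1) * M).
    apply: le_trans (_ : 21 * kap * m1%:R <= _); first by rewrite ler_wpM2r.
    by lra.
  have smL : s%:R * m1%:R * L%:R <= 21 * ((K + 1) * M) * (36 * ln k%:R).
    by apply: ler_pM; rewrite ?mulr_ge0.
  (* [k * L] is at most [36 * l], which cancels the denominator of [m2]: classifying all indices
     costs only a multiple of [T]. *)
  have kmL : k%:R * m2%:R * L%:R <= 36 * ((K11 + 1) * T).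
    apply: le_trans (_ : k%:R * m2%:R * (36 * ln k%:R) <= _).
      by rewrite ler_wpM2l ?mulr_ge0.
    by move: m2le; rewrite /l; lra.
  (* [ln k] is at least [1 / 2], so the first flattening sample, taken once, also fits into a
     multiple of [M * ln k]. *)
  have ML : M <= 2 * (M * ln k%:R) by have := ler_wpM2l M0 lnk; lra.
  have -> : B%:R = F1%:R + (4 * (s%:R * m1%:R * L%:R) +
      ((2 * F2%:R + 2 * N%:R) + 3 * (k%:R * m2%:R * L%:R))) :> R.
    by rewrite /B !(natrD, natrM); ring.
  rewrite KE in smL; rewrite K9E in Nle; rewrite K11E in kmL.
  exact: sample_budget F1le (le_trans kap1 Mk) ML smL F2le (le_trans l1 Rl) Nle kmL.
rewrite K2E in p1 p2; rewrite K9E in p3; rewrite K11E in p4 p5.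
exists (to_alg (cluster n k' s L F1 m1 F2 N m2 (m1%:R ^+ 2 * eps ^+ 2 / (20 * n%:R)))), B.
split; first by apply: to_alg_uses; apply: cost_cluster.
split=> // D I1 hI rE.
exact: (cluster_correct n0 e0 F1n F2n _ _ _ r0 rk hL hs p1 p2 p3 p4 p5 hI rE).
Qed.
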